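(* Let $\mathfrak{g}$ be a finite-dimensional Lie algebra over an algebraically closed field $k$ of characteristic zero. Assume that $\mathfrak{g}$ satisfies the Joseph–Shafrir conditions JS, and that $Y(\mathfrak{g})$ is freely generated (as a $k$-algebra) by homogeneous elements $f_1,\ldots,f_r$. Then $$3\,i(\mathfrak{g}) + 2\deg p_{\mathfrak{g}} \leq \dim\mathfrak{g} + 2\dim Z(\mathfrak{g}).$$ Moreover, equality occurs if and only if $\deg f_i \leq 2$ for all $i=1,\ldots,r$.
   Context: $Z(\mathfrak{g})$ is the center of $\mathfrak{g}$. $S(\mathfrak{g})$ is the symmetric algebra, identified with $k[x_1,\dots,x_n]$ for a basis $x_1,\dots,x_n$ of $\mathfrak{g}$, and $R(\mathfrak{g})$ is its quotient field. $Y(\mathfrak{g})=S(\mathfrak{g})^{\mathfrak{g}}$ is the algebra of invariants of the adjoint action (the Poisson center of $S(\mathfrak{g})$). Index: for $\xi\in\mathfrak{g}^*$ put $\mathfrak{g}(\xi)=\{x\in\mathfrak{g}\mid \xi([x,y])=0 \text{ for all } y\in\mathfrak{g}\}$; then $i(\mathfrak{g})=\min_{\xi}\dim\mathfrak{g}(\xi)$, equivalently $i(\mathfrak{g})=\dim\mathfrak{g}-\operatorname{rank}_{R(\mathfrak{g})}([x_i,x_j])$. Fundamental semi-invariant $p_{\mathfrak{g}}$: let $t=\dim\mathfrak{g}-i(\mathfrak{g})$, the rank of the structure matrix $B=([x_i,x_j])$ with entries in $S(\mathfrak{g})$. If $\mathfrak{g}$ is nonabelian, $p_{\mathfrak{g}}\in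 S(\mathfrak{g})$ is the greatest common divisor of the Pfaffians of the principal $t\times t$ submatrices of $B$ (well defined up to a nonzero scalar); if $\mathfrak{g}$ is abelian, $p_{\mathfrak{g}}=1$. $\mathfrak{g}$ satisfies JS if (a) $\mathfrak{g}$ is unimodular, i.e. $\operatorname{tr}(\operatorname{ad}x)=0$ for all $x\in\mathfrak{g}$; (b) $p_{\mathfrak{g}}\in Y(\mathfrak{g})$; and (c) $\operatorname{trdeg}_kY(\mathfrak{g})=i(\mathfrak{g})$. *)

(* Defs.v *)
From HB Require Import structures.
From mathcomp Require Import all_boot all_order all_algebra.
From mathcomp Require Import perm boolp.
From mathcomp Require Import mpoly.

Set Implicit Arguments.
Unset Strict Implicit.
Unset Printing Implicit Defensive.

Import GRing.Theory.

Local Open Scope ring_scope.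

HB.mixin Record Vector_isLie (k : fieldType) L of Vector k L := {
  lie : L -> L -> L;
  lie_linearl : forall y, linear (fun x => lie x y);
  lie_linearr : forall x, linear (lie x);
  liexx : forall x, lie x x = 0;
  lie_jacobi : forall x y z,
    lie x (lie y z) + lie y (lie z x) + lie z (lie x y) = 0
}.

#[short(type="lieAlgType")]
HB.structure Definition LieAlgebra (k : fieldType) :=
  {L of Vector_isLie k L & Vector k L}.

HB.instance Definition _ (k : fieldType) (L : lieAlgType k) (x : L) :=
  GRing.isSemilinear.Build k L L _ (@lie k L x)
    (GRing.semilinear_linear (lie_linearr x)).

Section LieAlgebra.

Variables (k : fieldType) (L : lieAlgType k).

Definition abelian_lie : Prop := forall x y : L, lie x y = 0.

Definition ad (x : L) : 'End(L) := linfun (lie x).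

Lemma ad_linear : linear ad.
Proof.
move=> a x y; apply/lfunP => z; rewrite add_lfunE scale_lfunE !lfunE.
exact: (lie_linearl z a x y).
Qed.

HB.instance Definition _ :=
  GRing.isSemilinear.Build k L 'End(L) _ ad (GRing.semilinear_linear ad_linear).

Definition lie_center : {vspace L} := lker (linfun ad).

Lemma lie_centerP (x : L) :
  reflect (forall y, lie x y = 0) (x \in lie_center).
Proof.
rewrite memv_ker lfunE; apply: (iffP eqP) => [xZ y|xZ].
  by have /lfunP/(_ y) := xZ; rewrite /= !lfunE.
by apply/lfunP => y; rewrite /= !lfunE; exact: xZ.
Qed.

Definition coad (xi : 'Hom(L, k^o)) (x : L) : 'Hom(L, k^o) := (xi \o ad x)%VF.

Lemma coad_linear xi : linear (coad xi).
Proof.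
move=> a x y; apply/lfunP => z.
by rewrite add_lfunE scale_lfunE !comp_lfunE linearP /= add_lfunE scale_lfunE linearP.
Qed.

HB.instance Definition _ xi :=
  GRing.isSemilinear.Build k L 'Hom(L, k^o) _ (coad xi)
    (GRing.semilinear_linear (coad_linear xi)).

Definition lie_stab (xi : 'Hom(L, k^o)) : {vspace L} := lker (linfun (coad xi)).

Lemma lie_stabP (xi : 'Hom(L, k^o)) (x : L) :
  reflect (forall y, xi (lie x y) = 0) (x \in lie_stab xi).
Proof.
rewrite memv_ker lfunE; apply: (iffP eqP) => [xZ y|xZ].
  by have /lfunP/(_ y) := xZ; rewrite /= !lfunE /= lfunE.
by apply/lfunP => y; rewrite /= !lfunE /= lfunE; exact: xZ.
Qed.

Fact lie_index_subproof :
  exists d, `[< exists xi, \dim (lie_stab xi) = d >].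
Proof. by exists (\dim (lie_stab 0)); apply/asboolP; exists 0. Qed.

Definition lie_index : nat := ex_minn lie_index_subproof.

End LieAlgebra.

Fact pfaffian_subproof t (i : 'I_t./2) : (i.*2.+1 < t)%N.
Proof. by rewrite -gtn_half_double. Qed.

Definition ord_even t (i : 'I_t./2) : 'I_t :=
  Ordinal (ltnW (pfaffian_subproof i)).
Definition ord_odd t (i : 'I_t./2) : 'I_t := Ordinal (pfaffian_subproof i).

(* Leibniz-type formula, meaningful for a skew-symmetric A in characteristic 0:
   Pf A = 1 / (2^m m!) \sum_s sgn(s) \prod_(i < m) A (s (2i)) (s (2i+1)),
   where t = 2m. *)
Definition pfaffian (k : fieldType) (R : comAlgType k) t (A : 'M[R]_t) : R :=
  if odd t then 0 else
  ((2 ^ t./2 * (t./2)`!)%:R^-1 : k) *: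
    \sum_(s : 'S_t) (-1) ^+ s *
      \prod_(i < t./2) A (s (ord_even i)) (s (ord_odd i)).

Section Polynomials.

Variables (k : fieldType) (n : nat).
Implicit Types (p q : {mpoly k[n]}) (P Y : {mpoly k[n]} -> Prop).

Definition tdeg p : nat := (msize p).-1.

Definition mdvd p q : Prop := exists c, q = c * p.

Definition is_gcd P p : Prop :=
  (forall q, P q -> mdvd p q) /\
  (forall c, (forall q, P q -> mdvd c q) -> mdvd c p).

Definition alg_independent r (f : r.-tuple {mpoly k[n]}) : Prop :=
  forall g : {mpoly k[r]}, g \mPo f = 0 -> g = 0.

(* The transcendence degree over k of a subalgebra Y of the domain k[n] (that
   is, of its quotient field) is the largest size of an algebraically
   independent family in Y. *)
Definition has_trdeg Y (d : nat) : Prop :=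
  (exists2 f : d.-tuple {mpoly k[n]},
     forall i, Y (tnth f i) & alg_independent f) /\
  (forall r (f : r.-tuple {mpoly k[n]}),
     (forall i, Y (tnth f i)) -> alg_independent f -> r <= d)%N.

Definition freely_generated Y r (f : r.-tuple {mpoly k[n]}) : Prop :=
  [/\ forall i, Y (tnth f i),
      alg_independent f &
      forall y, Y y -> exists g : {mpoly k[r]}, y = g \mPo f].

End Polynomials.

(* S(g) is identified with {mpoly k[n]} through a basis x of g, with 'X_i the
   image of the i-th vector of x. *)
Section SymmetricAlgebra.

Variables (k : fieldType) (L : lieAlgType k) (n : nat) (x : n.-tuple L).
Local Notation S := {mpoly k[n]}.

Definition sym_inj (v : L) : S := \sum_(i < n) coord x i v *: 'X_i.

Definition structure_mx : 'M[S]_n :=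
  \matrix_(i, j) sym_inj (lie (tnth x i) (tnth x j)).

(* The derivation of S(g) extending ad v. *)
Definition sym_ad (v : L) (f : S) : S :=
  \sum_(i < n) sym_inj (lie v (tnth x i)) * f^`M(i).

Definition Ysym (f : S) : Prop := forall v : L, sym_ad v f = 0.

Definition principal_pfaffian t (q : S) : Prop :=
  exists2 h : 'I_t -> 'I_n, {homo h : i j / (i < j)%N} &
    q = pfaffian (mxsub h h structure_mx).

(* In the nonabelian case p is any of the gcds, which agree up to a nonzero
   scalar. *)
Definition fundamental_semi_invariant (p : S) : Prop :=
  (abelian_lie L -> p = 1) /\
  (~ abelian_lie L ->
     is_gcd (principal_pfaffian (\dim {:L} - lie_index L)) p).

Definition unimodular : Prop :=
  forall v : L, \tr (\matrix_(i, j) coord x i (ad v (tnth x j))) = 0.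

Definition JS (p : S) : Prop :=
  [/\ unimodular, Ysym p & has_trdeg Ysym (lie_index L)].

End SymmetricAlgebra.

(* Main.v *)
Require Import Defs.
From HB Require Import structures.
From mathcomp Require Import all_boot all_order all_algebra.
From mathcomp Require Import perm boolp.
From mathcomp Require Import mpoly.
From mathcomp Require Import ring zify.

Set Implicit Arguments.
Unset Strict Implicit.
Unset Printing Implicit Defensive.

Import GRing.Theory.

Local Open Scope ring_scope.

(* Write n = dim g, r = i(g), t = n - r, let B be the structure matrix and J the
   Jacobian matrix of the generators f_1, ..., f_r (r is the index because
   trdeg Y(g) = i(g)). For a t x n matrix W put P(W) = Pf(W B W^T) and
   Q(W) = det(J; W). Since J B = 0, the functions P and Q are proportional, and
   as S(g) is factorial there is q in S(g) with p Q = q P.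

   Unimodularity and the invariance of p make q invariant. If q were not
   constant, take a prime factor u of q in the polynomial ring Y(g). Because
   u S(g) meets Y(g) in u Y(g), some prime factor v of u in S(g) satisfies
   v S(g) /\ Y(g) = u Y(g), so that r - 1 of the f_i stay algebraically
   independent modulo v. By the Jacobian criterion modulo v, the multiplicity of
   v in the minors of J is less than its multiplicity in u, although u
   divides these minors. Hence q is constant, and comparing degrees in
   p Q = q P gives sum_i (deg f_i - 1) + deg p = t / 2.

   Finally all deg f_i are positive, and dim Z(g) of them are equal to 1. *)

(** * Factorial rings and Gauss's lemma *)

(** Both forms depend on W only modulo the rows of J. The quotient has rank t, and alternating
    t-forms on it are unique up to a scalar; hence P and Q are proportional. An adjoint derivation
    moves both by the same infinitesimal change of W, except that the determinant picks up a trace,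
    which unimodularity removes.

    The obstacle is that a prime u of Y(g) may split or ramify in S(g). Write u = v^a w with v not
    dividing w. Replacing one row of a minor of J by a gradient gives a derivation that sends u to a
    multiple of this minor. If u divided all minors, the image of v^a w would be divisible by v^a.
    In characteristic zero, however, a derivation whose value at v is prime to v lowers the
    multiplicity to exactly a - 1. The Jacobian criterion modulo v supplies such a derivation.

    All of this takes place inside polynomial rings: proportionality is stated by cross products and
    independence modulo v by divisibility, so no quotient field or residue ring is formed. *)

Section Divisibility.

Variable R : idomainType.
Implicit Types (a b c u v : R) (s : seq R).

Definition rdvd a b := exists c, b = c * a.

Definition prime_elt v :=
  [/\ v != 0, ~ rdvd v 1 & forall a b, rdvd v (a * b) -> rdvd v a \/ rdvd v b].

(** Asking for prime rather than irreducible factors makes uniqueness automatic, so only existence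
    has to be proved and transported. *)
Definition factorial_ring :=
  forall a, a != 0 -> exists s u,
    [/\ forall v, v \in s -> prime_elt v, rdvd u 1 & a = u * \prod_(v <- s) v].

Lemma rdvd_refl a : rdvd a a. Proof. by exists 1; rewrite mul1r. Qed.

Lemma rdvd_trans b a c : rdvd a b -> rdvd b c -> rdvd a c.
Proof. by move=> [d ->] [e ->]; exists (e * d); rewrite mulrA. Qed.

Lemma rdvd_mull a b c : rdvd a b -> rdvd a (c * b).
Proof. by move=> [d ->]; exists (c * d); rewrite mulrA. Qed.

Lemma rdvd_mulr a b c : rdvd a b -> rdvd a (b * c).
Proof. by rewrite mulrC; apply: rdvd_mull. Qed.

Lemma rdvdr0 a : rdvd a 0. Proof. by exists 0; rewrite mul0r. Qed.

Lemma rdvdD a b c : rdvd a b -> rdvd a c -> rdvd a (b + c).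
Proof. by move=> [d ->] [e ->]; exists (d + e); rewrite mulrDl. Qed.

Lemma rdvdN a b : rdvd a b -> rdvd a (- b).
Proof. by move=> [d ->]; exists (- d); rewrite mulNr. Qed.

Lemma rdvdB a b c : rdvd a b -> rdvd a c -> rdvd a (b - c).
Proof. by move=> ab ac; apply/rdvdD/rdvdN. Qed.

Lemma rdvd_sum (I : Type) (r : seq I) (P : pred I) (F : I -> R) a :
  (forall i, P i -> rdvd a (F i)) -> rdvd a (\sum_(i <- r | P i) F i).
Proof.
move=> aF; elim/big_rec: _ => [|i y Pi ay]; first exact: rdvdr0.
by apply: rdvdD => //; apply: aF.
Qed.

Lemma rdvd_mul2l a b c : a != 0 -> rdvd (a * b) (a * c) -> rdvd b c.
Proof.
by move=> a0 [d]; rewrite mulrCA => /(mulfI a0) ->; exists d.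
Qed.

Lemma rdvd_mul a b c d : rdvd a b -> rdvd c d -> rdvd (a * c) (b * d).
Proof. by move=> [e ->] [f ->]; exists (e * f); rewrite mulrACA. Qed.

Lemma prime_elt_dvd_prod (I : eqType) v (s : seq I) (F : I -> R) :
  prime_elt v -> rdvd v (\prod_(i <- s) F i) -> exists2 i, i \in s & rdvd v (F i).
Proof.
move=> [_ v1 vM]; elim: s => [|w s IHs]; first by rewrite big_nil.
rewrite big_cons => /vM[vw|/IHs[i si vi]]; first by exists w; rewrite ?mem_head.
by exists i; rewrite // inE si orbT.
Qed.

Lemma prime_elt_ind (P : R -> Prop) : factorial_ring ->
  (forall u, rdvd u 1 -> P u) ->
  (forall v a, prime_elt v -> a != 0 -> P a -> P (v * a)) ->
  forall a, a != 0 -> P a.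
Proof.
move=> fR Pu PM a /fR[s [u [sP u1 ->]]].
elim: s sP => [|v s IHs] sP; first by rewrite big_nil mulr1; apply: Pu.
have s'P w : w \in s -> prime_elt w by move=> sw; apply: sP; rewrite inE sw orbT.
have u0 : u != 0 by apply/eqP=> u0; case: u1 => c; rewrite u0 mulr0 => /eqP; rewrite oner_eq0.
rewrite big_cons mulrCA; apply: PM; [by apply: sP; rewrite mem_head| |exact: IHs].
rewrite mulf_neq0 //; rewrite prodf_seq_neq0; apply/allP => w /s'P[].
by rewrite implyTb.
Qed.

(* If no prime divides all the [F i], then every common divisor of the
   multiples [b * F i] divides [b]. *)
Lemma rdvd_coprime_family (I : Type) (F : I -> R) a b : factorial_ring ->
  a != 0 -> (forall v, prime_elt v -> ~ forall i, rdvd v (F i)) ->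
  (forall i, rdvd a (b * F i)) -> rdvd a b.
Proof.
move=> fR a0 Fcop; move: a a0 b.
apply: (prime_elt_ind fR) => [u u1 b _|v a vP a0 IHa b vaF].
  by apply: (rdvd_trans u1); exists b; rewrite mulr1.
have /existsNP[i viN] := Fcop v vP.
have [v0 _ vM] := vP.
have /vM[[c eb]|//] : rdvd v (b * F i).
  by apply: rdvd_trans (vaF i); exists a; rewrite mulrC.
rewrite eb mulrC; apply: rdvd_mul; last exact: rdvd_refl.
apply: IHa => j; have := vaF j; rewrite eb (mulrC c) -mulrA.
exact: rdvd_mul2l.
Qed.

End Divisibility.

Section GaussLemma.

Variable R : idomainType.
Hypothesis fR : factorial_ring R.
Implicit Types (p q f g h : {poly R}).

Lemma rdvd_polyCP (v : R) f : rdvd v%:P f <-> forall i, rdvd v f`_i.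
Proof.
split=> [[c ->] i|vf]; first by exists c`_i; rewrite coefMC.
have {}vf i : exists c, f`_i = c * v by apply: vf.
exists (\poly_(i < size f) sval (cid (vf i))); apply/polyP=> i.
rewrite coefMC coef_poly; case: ltnP => [_|fi]; first by case: cid.
by rewrite nth_default // mul0r.
Qed.

Lemma prime_polyC (v : R) : prime_elt v -> prime_elt v%:P.
Proof.
move=> [v0 v1 vM]; split; first by rewrite polyC_eq0.
  by move=> /rdvd_polyCP /(_ 0); rewrite coef1.
move=> f g vfg; apply: contrapT => /not_orP[vf vg].
(* Take the least indices [i] and [j] whose coefficients in [f] and [g] are not divisible by [v]: in
   the coefficient of index [i + j] of the product, all other terms are divisible by [v]. *)
have exf : exists i, `[< ~ rdvd v f`_i >].
  have := contra_not (rdvd_polyCP v f).2 vf.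
  by move=> /existsNP[i vi]; exists i; apply/asboolP.
have exg : exists i, `[< ~ rdvd v g`_i >].
  have := contra_not (rdvd_polyCP v g).2 vg.
  by move=> /existsNP[i vi]; exists i; apply/asboolP.
case: (ex_minnP exf) => i /asboolP vfi mini.
case: (ex_minnP exg) => j /asboolP vgj minj.
have ltf i' : (i' < i)%N -> rdvd v f`_i'.
  by move=> lt; apply: contrapT => /asboolP/mini; rewrite leqNgt lt.
have ltg i' : (i' < j)%N -> rdvd v g`_i'.
  by move=> lt; apply: contrapT => /asboolP/minj; rewrite leqNgt lt.
have /rdvd_polyCP/(_ (i + j)%N) := vfg.
rewrite coefM (bigD1 (Ordinal (leq_addr j i : i < (i + j).+1)%N)) //= addKn.
set s := (X in _ + X) => vs.
have : rdvd v (f`_i * g`_j).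
  rewrite -[f`_i * _](addrK s); apply: rdvdB => //.
  apply: rdvd_sum => l; rewrite -val_eqE /= => li.
  have [lt|gt|/eqP] := ltngtP l i; [|  |by rewrite (negbTE li)].
    by apply/rdvd_mulr/ltf.
  apply/rdvd_mull/ltg; have lij : (l <= i + j)%N by rewrite -ltnS ltn_ord.
  by rewrite -(ltn_add2r l) subnK // [ltnLHS]addnC ltn_add2l.
by move=> /vM[].
Qed.

Definition primitive f := forall v, prime_elt v -> ~ rdvd v%:P f.

(** A prime dividing all coefficients divides the leading one, so each extraction uses up one of its
    prime factors; their number is the induction variable. *)
Lemma primitive_part f : f != 0 ->
  exists c g, [/\ c != 0, primitive g & f = c%:P * g].
Proof.
move=> f0; have lf0 : lead_coef f != 0 by rewrite lead_coef_eq0.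
have [s [u [sP u1 ef]]] := fR lf0.
have [m] := ubnP (size s); elim: m s f f0 lf0 u u1 ef sP => // m IHm s f f0 lf0 u u1 ef sP sm.
have [fprim|/existsNP[v /not_implyP[vP /contrapT[g eg]]]] := pselect (primitive f).
  by exists 1, f; rewrite mul1r oner_eq0; split.
have g0 : g != 0 by apply: contraNneq f0 => g0; rewrite eg g0 mul0r.
have lfg : lead_coef f = v * lead_coef g by rewrite eg lead_coefM lead_coefC mulrC.
have [v0 vN1 vM] := vP.
have [w sw [e we]] : exists2 w, w \in s & rdvd v w.
  have /vM[vu|] : rdvd v (u * \prod_(i <- s) i).
  - by rewrite -ef lfg; exists (lead_coef g); rewrite mulrC.
  - by case: vN1; apply: rdvd_trans u1.
  - exact: prime_elt_dvd_prod.
have [w0 w1 wM] := sP w sw.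
have [] : rdvd w e \/ rdvd w v by apply: wM; rewrite -we; apply: rdvd_refl.
  move=> [d ed]; case: vN1; exists d.
  by apply: (mulfI w0); rewrite mulr1 {1}we ed; ring.
move=> [d ed].
have de : d * e = 1 by apply: (mulIf v0); rewrite -mulrA -we mul1r.
have lg : lead_coef g = (u * e) * \prod_(i <- rem w s) i.
  apply: (mulfI v0); rewrite -lfg ef (perm_big _ (perm_to_rem sw)) big_cons /= {1}we.
  by rewrite !mulrA; congr (_ * _); rewrite mulrC mulrA [v * _]mulrC.
have [] := IHm (rem w s) g g0 _ (u * e) _ lg.
- by rewrite lead_coef_eq0.
- by rewrite -[1]mul1r; apply: rdvd_mul => //; exists d.
- by move=> x /mem_rem/sP.
- by rewrite size_rem // -ltnS prednK //; case: (s) sw.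
move=> c [g1 [c0 g1P eg1]]; exists (c * v), g1; split=> //; first by rewrite mulf_neq0.
by rewrite eg eg1 polyCM mulrAC.
Qed.

(** The primes of [c] are cancelled one at a time: each divides the cofactor of [f], because it
    cannot divide the primitive [f]. *)
Lemma primitive_dvd f g (c : R) :
  primitive f -> c != 0 -> rdvd f (c%:P * g) -> rdvd f g.
Proof.
move=> fP c0; move: c c0 g; apply: (prime_elt_ind fR) => [u [d ud] g fg|v a vP a0 IHa g].
  apply: (rdvd_trans fg); exists d%:P.
  by rewrite mulrA -polyCM -ud mul1r.
move=> [h eh]; have [v0 _ vM] := prime_polyC vP.
have /vM[[d ed]|vf] : rdvd v%:P (h * f); last by case: (fP v vP).
  by rewrite -eh polyCM -mulrA; exists (a%:P * g); rewrite mulrC.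
apply: IHa; exists d; apply: (mulfI v0).
transitivity ((v * a)%:P * g); first by rewrite polyCM; ring.
by rewrite eh ed; ring.
Qed.

Lemma primitive_const_unit f g (c : R) : primitive f -> f != 0 -> f = g * c%:P -> rdvd c 1.
Proof.
move=> fP f0 efg; have c0 : c != 0 by apply: contraNneq f0 => c0; rewrite efg c0 mulr0.
have [s [u [sP u1 ec]]] := fR c0.
case: s sP ec => [|v s] sP ec; first by rewrite ec big_nil mulr1.
case: (fP v); first by apply: sP; rewrite mem_head.
exists (g * (u * \prod_(i <- s) i)%:P).
by rewrite efg ec big_cons !polyCM; ring.
Qed.

(* The element of least degree in the ideal (f, g) is, up to content, a common
   divisor of f and g; hence it is either associated to f or constant. *)
Lemma primitive_irreducible_prime f : primitive f -> (1 < size f)%N ->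
  (forall g h, f = g * h -> (size g <= 1)%N \/ (size h <= 1)%N) -> prime_elt f.
Proof.
move=> fP sf fI; have f0 : f != 0 by rewrite -size_poly_gt0 (ltn_trans _ sf).
split=> // [[g /(congr1 (size : {poly R} -> nat))]|].
  have [->|g0] := eqVneq g 0; first by rewrite mul0r size_poly0 size_poly1.
  rewrite size_poly1 size_mul // => e; move: sf.
  by move: g0; rewrite -size_poly_gt0; case: (size g) e => // a /=; case: (size f) => //= -[|?]; rewrite ?addnS.
move=> g' h' fgh.
pose g : {poly R} := g'; pose h : {poly R} := h'; rewrite -[g']/g -[h']/h in fgh *.
pose S m := exists a b m' : {poly R}, [/\ m' = a * f + b * g, m' != 0 & size m' = m].
have exS : exists m, `[< S m >].
  by exists (size f); apply/asboolP; exists 1, 0, f; rewrite mul1r mul0r addr0.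
case: (ex_minnP exS) => _ /asboolP[a [b [m [em m0 <-]]]] mmin.
(* Pseudo-division by [m] costs a power of its leading coefficient; the remainder stays in the ideal
   and is shorter than [m], so it vanishes. *)
have dvdm (x : {poly R}) : (exists c d : {poly R}, x = c * f + d * g) -> exists2 c : R, c != 0 & rdvd m (c%:P * x).
  move=> [c [d ex]]; exists (lead_coef m ^+ scalp x m).
    by rewrite expf_neq0 // lead_coef_eq0.
  have := Pdiv.Idomain.divp_eq x m; rewrite -mul_polyC => ->.
  have [->|r0] := eqVneq (x %% m) 0; first by rewrite addr0; exists (x %/ m).
  have := ltn_modp x m; rewrite m0 => lt.
  have /mmin : `[< S (size (x %% m)) >]; last by rewrite leqNgt lt.
  apply/asboolP; set l := (lead_coef m ^+ scalp x m)%:P.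
  exists (l * c - (x %/ m) * a), (l * d - (x %/ m) * b), (x %% m); split=> //.
  have -> : x %% m = l * x - (x %/ m) * m.
    by rewrite /l mul_polyC (Pdiv.Idomain.divp_eq x m) addrC addKr.
  by rewrite {2}em ex !mulrDr !mulrBl !mulrA opprD addrACA.
have [c [m1 [c0 m1P em1]]] := primitive_part m0.
have m1m : rdvd m1 m by exists c%:P.
have [|cf cf0 /(rdvd_trans m1m)/(primitive_dvd m1P cf0)[s efs]] := dvdm f.
  by exists 1, 0; rewrite mul1r mul0r addr0.
have [|cg cg0 /(rdvd_trans m1m)/(primitive_dvd m1P cg0) m1g] := dvdm g.
  by exists 0, 1; rewrite mul1r mul0r add0r.
have [/size1_polyC es|/size1_polyC em1C] := fI s m1 efs; [left|right].
  have [e e1] : rdvd (s`_0) 1.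
    by apply: (primitive_const_unit (g := m1) fP f0); rewrite -es mulrC.
  apply: rdvd_trans m1g; exists e%:P.
  by rewrite efs es mulrA -polyCM -e1 mul1r.
have mC : m = (c * m1`_0)%:P by rewrite em1 {1}em1C polyCM.
apply: (primitive_dvd (c := c * m1`_0) fP).
  by rewrite -polyC_eq0 -mC.
rewrite -mC em mulrDl; apply: rdvdD.
  by exists (a * h); rewrite mulrAC.
by rewrite -mulrA; apply: rdvd_mull.
Qed.

(** Induction on the degree: once the content is factored in [R], the primitive part is constant,
    prime, or a product of two factors of smaller degree. *)
Lemma factorial_poly : factorial_ring {poly R}.
Proof.
have fC (c : R) : c != 0 -> exists s u,
    [/\ forall v, v \in s -> prime_elt v, rdvd u 1 & c%:P = u * \prod_(v <- s) v].
  move: c; apply: (prime_elt_ind fR) => [u [d ud]|v a vP a0 [s [u [sP u1 ea]]]].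
    exists [::], u%:P; rewrite big_nil mulr1; split=> //.
    by exists d%:P; rewrite -polyCM -ud.
  exists (v%:P :: s), u; rewrite big_cons polyCM ea mulrCA; split=> //.
  by move=> w /predU1P[->|/sP//]; apply: prime_polyC.
move=> f; have [m] := ubnP (size f); elim: m f => // m IHm f sfm f0.
have [c [g [c0 gP ef]]] := primitive_part f0.
have [s [u [sP u1 ec]]] := fC c c0.
suff [s' [u' [s'P u1' eg]]] : exists s u,
    [/\ forall v, v \in s -> prime_elt v, rdvd u 1 & g = u * \prod_(v <- s) v].
  exists (s ++ s'), (u * u'); rewrite big_cat /= ef ec eg mulrACA; split=> //.
    by move=> v; rewrite mem_cat => /orP[/sP|/s'P].
  by rewrite -[1]mul1r; apply: rdvd_mul.
have g0 : g != 0 by apply: contraNneq f0 => g0; rewrite ef g0 mulr0.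
have sg : size g = size f by rewrite ef size_Cmul.
have [sg1|sg1] := leqP (size g) 1.
  by have := size1_polyC sg1 => eg; rewrite eg; apply: fC; rewrite -polyC_eq0 -eg.
have [gI|/existsNP[a /existsNP[b /not_implyP[eg /not_orP[/negP a1 /negP b1]]]]] :=
  pselect (forall a b, g = a * b -> (size a <= 1)%N \/ (size b <= 1)%N).
  exists [:: g], 1; rewrite big_seq1 mul1r; split=> [v||//]; last exact: rdvd_refl.
  by rewrite inE => /eqP->; apply: primitive_irreducible_prime.
rewrite -!ltnNge in a1 b1.
have a0 : a != 0 by rewrite -size_poly_gt0 (ltn_trans _ a1).
have b0 : b != 0 by rewrite -size_poly_gt0 (ltn_trans _ b1).
have sab : size f = (size a + size b).-1 by rewrite -sg eg size_mul.
have lt1 : (size a < m)%N.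
  by move: sfm; rewrite sab ltnS; apply: leq_trans; case: (size b) b1 => [|[|y]] // _; rewrite !addnS /= ltnS leq_addr.
have lt2 : (size b < m)%N.
  by move: sfm; rewrite sab ltnS; apply: leq_trans; case: (size a) a1 => [|[|y]] // _; rewrite !addSn /= ltnS leq_addl.
have [s1 [u1' [s1P u11 ea]]] := IHm a lt1 a0.
have [s2 [u2 [s2P u21 eb]]] := IHm b lt2 b0.
exists (s1 ++ s2), (u1' * u2); rewrite big_cat /= eg ea eb mulrACA; split=> //.
  by move=> v; rewrite mem_cat => /orP[/s1P|/s2P].
by rewrite -[1]mul1r; apply: rdvd_mul.
Qed.

End GaussLemma.

Lemma rdvd_rmorph (R S : idomainType) (phi : {rmorphism R -> S}) (a b : R) :
  rdvd a b -> rdvd (phi a) (phi b).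
Proof. by move=> [c ->]; exists (phi c); rewrite rmorphM. Qed.

Lemma factorial_iso (R S : idomainType) (phi : {rmorphism R -> S})
    (psi : {rmorphism S -> R}) :
  cancel phi psi -> cancel psi phi -> factorial_ring S -> factorial_ring R.
Proof.
move=> phiK psiK fS a a0.
have inj_phi := can_inj phiK.
have phi0 b : (phi b == 0) = (b == 0) by rewrite -(inj_eq inj_phi) rmorph0.
have dvd_phi b c : rdvd (phi b) (phi c) -> rdvd b c.
  by move/(rdvd_rmorph psi); rewrite !phiK.
have [|s [u [sP u1 ea]]] := fS (phi a); first by rewrite phi0.
exists (map psi s), (psi u); split.
- move=> _ /mapP[v /sP[v0 v1 vM] ->]; split.
  + by rewrite -phi0 psiK.
  + by move/(rdvd_rmorph phi); rewrite psiK rmorph1.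
  + move=> b c /(rdvd_rmorph phi); rewrite psiK rmorphM => /vM.
    by case=> vb; [left|right]; apply: dvd_phi; rewrite psiK.
- by rewrite -(rmorph1 psi); apply: rdvd_rmorph.
- by rewrite -[LHS]phiK ea rmorphM rmorph_prod big_map.
Qed.

(** * Factoriality of polynomial rings in several variables *)

Section MpolyFactorial.

Variable (k : fieldType).

Section Iso.
Variable n : nat.

Definition poly_mpoly (q : {poly {mpoly k[n]}}) : {mpoly k[n.+1]} :=
  (map_poly (@mwiden n k) q).['X_ord_max].

Lemma poly_mpoly_monoid_morphism : monoid_morphism poly_mpoly.
Proof.
split=> [|p q]; rewrite /poly_mpoly; first by rewrite rmorph1 hornerC.
by rewrite rmorphM hornerM.
Qed.

Lemma poly_mpoly_zmod_morphism : zmod_morphism poly_mpoly.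
Proof. by move=> p q; rewrite /poly_mpoly rmorphB hornerD hornerN. Qed.

HB.instance Definition _ :=
  GRing.isZmodMorphism.Build {poly {mpoly k[n]}} {mpoly k[n.+1]} poly_mpoly
    poly_mpoly_zmod_morphism.
HB.instance Definition _ :=
  GRing.isMonoidMorphism.Build {poly {mpoly k[n]}} {mpoly k[n.+1]} poly_mpoly
    poly_mpoly_monoid_morphism.

Lemma muniX m : @muni n k 'X_[m] =
  'X_[[multinom m (widen_ord (leqnSn n) i) | i < n]] *: 'X^(m ord_max).
Proof. by rewrite muniE msuppX big_seq1 mcoeffX eqxx scale1r. Qed.

Lemma muniK : cancel (@muni n k) poly_mpoly.
Proof.
move=> p; rewrite muniE [RHS](mpolyE p) raddf_sum /=; apply: eq_bigr => m _.
rewrite -!mul_polyC !rmorphM /= /poly_mpoly !map_polyC rmorphXn /= map_polyX.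
rewrite !hornerE /= mwidenZ mwidenX -scalerAl; congr (_ *: _).
rewrite mpolyXn -mpolyXD; congr 'X_[_]; apply/mnmP=> i; rewrite mnmDE mulmnE mnm1E.
have [lt|] := ltnP i n.
  have -> : i = widen_ord (leqnSn n) (Ordinal lt) by apply: val_inj.
  rewrite mnmwiden_widen mnmE -val_eqE /= gtn_eqF // addn0.
  by [].
move=> le; have -> : i = ord_max by apply/val_inj/eqP; rewrite eqn_leq le -ltnS ltn_ord.
by rewrite mnmwiden_ordmax eqxx mul1n add0n.
Qed.

Lemma poly_mpolyK : cancel poly_mpoly (@muni n k).
Proof.
have KC (c : {mpoly k[n]}) : muni (mwiden c) = c%:P.
  rewrite [in RHS](mpolyE c) [in LHS](mpolyE c) (raddf_sum (@mwiden n k)).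
  rewrite (raddf_sum (@muni n k)) (raddf_sum (@polyC {mpoly k[n]})); apply: eq_bigr => m _ /=.
  rewrite mwidenZ muniZ mwidenX muniX mnmwiden_ordmax expr0 -mul_polyC.
  rewrite alg_polyC -polyCM mul_mpolyC; congr (_ *: 'X_[_])%:P; apply/mnmP=> i.
  by rewrite mnmE mnmwiden_widen.
elim/poly_ind=> [|q c IHq]; first by rewrite !rmorph0.
rewrite !rmorphD !rmorphM /= IHq /poly_mpoly map_polyX map_polyC hornerX hornerC KC.
rewrite muniX mnm1E eqxx expr1; congr (_ * _ + _).
rewrite (_ : [multinom _ | _ < _] = 0%MM) ?mpolyX0 ?scale1r //.
by apply/mnmP=> i; rewrite mnmE mnm1E mnm0E -val_eqE /= gtn_eqF.
Qed.

End Iso.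

Lemma factorial_mpoly n : factorial_ring {mpoly k[n]}.
Proof.
elim: n => [|n IHn]; last exact: (factorial_iso (@muniK n) (@poly_mpolyK n)) (factorial_poly IHn).
move=> a a0; exists [::], a; rewrite big_nil mulr1; split=> //.
have ea : a = (a@_0)%:MP.
  apply/mpolyP=> m; have -> : m = 0%MM by apply/mnmP=> -[].
  by rewrite mcoeffC eqxx mulr1.
have c0 : a@_0 != 0 by apply: contraNneq a0 => c0; rewrite ea c0 mpolyC0.
by exists (a@_0)^-1%:MP; rewrite {2}ea -mpolyCM mulVf.
Qed.

End MpolyFactorial.

(** * Pfaffians *)

(** Leaving out the factor 1/(2^m m!) of [pfaffian] gives a sum that makes sense over any
    commutative ring, in particular over [{poly S}]. For even [t] in characteristic zero the two
    differ by a nonzero scalar. *)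
Definition pfaffian_sum (R : comNzRingType) t (A : 'M[R]_t) : R :=
  \sum_(s : 'S_t) (-1) ^+ s *
    \prod_(i < t./2) A (s (ord_even i)) (s (ord_odd i)).

Section EvenPairs.

Variables (t : nat) (t_even : ~~ odd t).

Definition ord_pair (x : 'I_t./2 * bool) : 'I_t :=
  if x.2 then ord_odd x.1 else ord_even x.1.

Lemma val_ord_pair i b : ord_pair (i, b) = (b + i.*2)%N :> nat.
Proof. by case: b. Qed.

Lemma ord_pair_inj : injective ord_pair.
Proof.
move=> [i b] [j c] /(congr1 val); rewrite /= !val_ord_pair => e.
have ebc : b = c by have := congr1 odd e; rewrite !oddD !odd_double !addbF !oddb.
move: e; rewrite ebc => /addnI/(congr1 half); rewrite !doubleK => e.
by congr (_, _); apply: val_inj.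
Qed.

Lemma ord_pair_bij : bijective ord_pair.
Proof.
apply: inj_card_bij; first exact: ord_pair_inj.
by rewrite card_prod card_bool !card_ord muln2 even_halfK.
Qed.

Lemma big_ord_pair (R : Type) (idx : R) (op : Monoid.com_law idx) (G : 'I_t -> R) :
  \big[op/idx]_(j < t) G j =
  \big[op/idx]_(i < t./2) op (G (ord_even i)) (G (ord_odd i)).
Proof.
rewrite (reindex ord_pair) /=; last exact/onW_bij/ord_pair_bij.
rewrite -(pair_bigA _ (fun i b => G (ord_pair (i, b)))) /=.
by apply: eq_bigr => i _; rewrite big_bool Monoid.mulmC.
Qed.

Lemma ord_pair_eq (i j : 'I_t./2) b c :
  (ord_pair (i, b) == ord_pair (j, c)) = (i == j) && (b == c).
Proof. by rewrite (inj_eq ord_pair_inj) xpair_eqE. Qed.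

Variant ord_pair_spec (x : 'I_t) : Type := OrdPairSpec i b of x = ord_pair (i, b).

Lemma ord_pairP x : ord_pair_spec x.
Proof.
have /forallP/(_ x)/existsP/sigW[[i b] /eqP e] : [forall x, exists y, x == ord_pair y].
  have [g _ gK] := ord_pair_bij.
  by apply/forallP=> y; apply/existsP; exists (g y); rewrite gK.
exact: (OrdPairSpec e).
Qed.

Section Congruence.

Variable R : comNzRingType.

(* Expanding the entries of M A M^T turns the sum over permutations into a
   determinant of columns of M, indexed by a function which may be assumed to
   be a permutation. *)
Lemma pfaffian_sum_congr (M A : 'M[R]_t) :
  pfaffian_sum (M *m A *m M^T) = \det M * pfaffian_sum A.
Proof.
pose D (f : {ffun 'I_t -> 'I_t}) := \det (\matrix_(i, j) M j (f i)).
pose w (f : 'I_t -> 'I_t) := \prod_(i < t./2) A (f (ord_even i)) (f (ord_odd i)).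
have [g gK Kg] := ord_pair_bij.
(* A function on ['I_t] amounts to a pair of indices for each block, the shape in which the product
   of double sums is distributed. *)
pose h (F : {ffun 'I_t./2 -> 'I_t * 'I_t}) : {ffun 'I_t -> 'I_t} :=
  [ffun j => let: (i, b) := g j in if b then (F i).2 else (F i).1].
pose h' (f : {ffun 'I_t -> 'I_t}) : {ffun 'I_t./2 -> 'I_t * 'I_t} :=
  [ffun i => (f (ord_even i), f (ord_odd i))].
have ge i : g (ord_even i) = (i, false) by rewrite -(gK (i, false)).
have go i : g (ord_odd i) = (i, true) by rewrite -(gK (i, true)).
have hK : cancel h h'.
  by move=> F; apply/ffunP=> i; rewrite !ffunE ge go; case: (F i).
have Kh : cancel h' h.
  move=> f; apply/ffunP=> j; case: (ord_pairP j) => i b ->.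
  by rewrite ffunE gK !ffunE; case: b.
transitivity (\sum_(f : {ffun 'I_t -> 'I_t}) w f * D f).
  under [RHS]eq_bigr => f _.
    rewrite /D /determinant mulr_sumr.
    over.
  rewrite exchange_big /=; apply: eq_bigr => s _.
  transitivity ((-1) ^+ s * \prod_(i < t./2) \sum_(c : 'I_t * 'I_t)
      M (s (ord_even i)) c.1 * A c.1 c.2 * M (s (ord_odd i)) c.2).
    congr (_ * _); apply: eq_bigr => i _.
    rewrite mxE -(pair_bigA _ (fun a b => M (s (ord_even i)) a * A a b * M (s (ord_odd i)) b)).
    rewrite exchange_big /=; apply: eq_bigr => b _; rewrite !mxE mulr_suml.
    by apply: eq_bigr => a _.
  rewrite bigA_distr_bigA mulr_sumr (reindex h') /=; last first.
    by exists h => ? _; [exact: Kh|exact: hK].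
  apply: eq_bigr => f _; rewrite mulrCA; congr (_ * _).
  rewrite big_ord_pair -big_split /=; apply: eq_bigr => i _.
  by rewrite !mxE !ffunE /= mulrAC mulrC.
rewrite (bigID (fun f : {ffun _ -> _} => injectiveb f)) /= addrC big1 ?add0r => [|f]; last first.
  move=> /injectivePn[x1 [x2 ne12 e12]]; rewrite [D f](determinant_alternate ne12) ?mulr0 //.
  by move=> j; rewrite !mxE e12.
rewrite (reindex (@pval _)) /=; last first.
  pose in_Sn := insubd (1%g : 'S_t).
  by exists in_Sn => /= f Uf; first apply: val_inj; apply: insubdK.
rewrite mulr_sumr; apply: eq_big => [s|s _]; first by apply/injectiveP=> a b; rewrite !pvalE => /perm_inj.
rewrite mulrCA mulrA mulrC; congr (_ * _); last first.
  by apply: eq_bigr => i _; rewrite !pvalE.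
rewrite -(det_tr M) -det_perm -det_mulmx -row_permE.
by congr (\det _); apply/matrixP=> i j; rewrite !mxE pvalE.
Qed.

End Congruence.
End EvenPairs.

(* Entries of the block-diagonal matrix with blocks [[0, 1], [-1, 0]]. *)
Definition symp (R : pzRingType) (a b : nat) : R :=
  if a./2 == b./2 then (odd b)%:R - (odd a)%:R else 0.

Definition symp_mx (R : pzRingType) t : 'M[R]_t := \matrix_(i, j) symp R i j.

(** * The Pfaffian sum of the standard symplectic matrix *)

Section SymplecticPfaffian.

Variables (t : nat) (t_even : ~~ odd t) (R : comNzRingType).
Implicit Types (s : 'S_t) (p : 'S_t./2) (i j : 'I_t./2).

Local Notation op := (@ord_pair t).

Lemma symp_pair i j b c :
  symp R (op (i, b)) (op (j, c)) = if i == j then c%:R - b%:R else 0.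
Proof.
rewrite /symp !val_ord_pair !oddD !odd_double !addbF !oddb.
by rewrite -val_eqE !half_bit_double.
Qed.

Definition pair_lift_fun p (x : 'I_t) : 'I_t :=
  if insub x./2 is Some i then op (p i, odd x) else x.

Lemma pair_lift_funE p i b : pair_lift_fun p (op (i, b)) = op (p i, b).
Proof.
rewrite /pair_lift_fun val_ord_pair half_bit_double oddD odd_double addbF oddb.
by rewrite valK.
Qed.

Lemma pair_lift_inj p : injective (pair_lift_fun p).
Proof.
move=> x y; case: (ord_pairP t_even x) => i b ->; case: (ord_pairP t_even y) => j c ->.
by rewrite !pair_lift_funE => /ord_pair_inj[/perm_inj-> ->].
Qed.

Definition pair_lift p : 'S_t := perm (@pair_lift_inj p).

Lemma pair_liftE p i b : pair_lift p (op (i, b)) = op (p i, b).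
Proof. by rewrite permE pair_lift_funE. Qed.

Lemma pair_liftM : {morph pair_lift : p q / (p * q)%g}.
Proof.
move=> p q; apply/permP=> x; case: (ord_pairP t_even x) => i b ->.
by rewrite permM !pair_liftE permM.
Qed.

Lemma pair_lift1 : pair_lift 1 = 1%g.
Proof.
apply/permP=> x; case: (ord_pairP t_even x) => i b ->.
by rewrite pair_liftE !perm1.
Qed.

Lemma pair_lift_tperm i j :
  pair_lift (tperm i j) =
  (tperm (op (i, false)) (op (j, false)) * tperm (op (i, true)) (op (j, true)))%g.
Proof.
apply/permP=> x; case: (ord_pairP t_even x) => l b ->.
rewrite pair_liftE permM !permE /= !ord_pair_eq; case: b; rewrite /= ?andbF ?andbT /=.
  rewrite !ord_pair_eq !andbT.
  by case: (eqVneq l i) => // _; case: (eqVneq l j).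
rewrite 2!(fun_if (fun y => y == op (i, true))) 2!(fun_if (fun y => y == op (j, true))).
by rewrite !ord_pair_eq !andbF !if_same; case: (eqVneq l i) => // _; case: (eqVneq l j).
Qed.

(** A transposition of two blocks lifts to a product of two transpositions. *)
Lemma even_pair_lift p : odd_perm (pair_lift p) = false.
Proof.
have [ts -> _] := prod_tpermP p.
elim: ts => [|[i j] ts IHts]; first by rewrite big_nil pair_lift1 odd_perm1.
by rewrite big_cons pair_liftM odd_permM IHts addbF pair_lift_tperm odd_permM !odd_tperm
  !ord_pair_eq !andbT addbb.
Qed.

Definition symp_term s : R :=
  (-1) ^+ s * \prod_(i < t./2) symp R (s (ord_even i)) (s (ord_odd i)).

Definition pair_preserving s := [forall i, (s (ord_even i))./2 == (s (ord_odd i))./2].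

Lemma symp_term_lift s p : symp_term (s * pair_lift p)%g = symp_term s.
Proof.
rewrite /symp_term odd_permM even_pair_lift addbF; congr (_ * _).
apply: eq_bigr => i _; rewrite !permM.
case: (ord_pairP t_even (s (ord_even i))) => a b ->.
case: (ord_pairP t_even (s (ord_odd i))) => c d ->.
by rewrite !pair_liftE !symp_pair (inj_eq perm_inj).
Qed.

(** The swap inside a block changes the sign of the permutation and the sign of one factor. *)
Lemma symp_term_flip s i : symp_term (tperm (ord_even i) (ord_odd i) * s)%g = symp_term s.
Proof.
have E j : ord_even j = op (j, false) by [].
have O j : ord_odd j = op (j, true) by [].
have ne (j : 'I_t./2) : ord_even j != ord_odd j by rewrite E O ord_pair_eq andbF.
rewrite /symp_term odd_permM odd_tperm ne signr_addb expr1 mulN1r mulNr -mulrN; congr (_ * _).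
rewrite (bigD1 i) // [in RHS](bigD1 i) //= -mulNr; congr (_ * _).
  rewrite !permM tpermL tpermR.
  by rewrite /symp eq_sym; case: eqP; rewrite ?opprB ?oppr0.
apply: eq_bigr => j ji; rewrite !permM !tpermD // ?E ?O ord_pair_eq ?andbF //.
  by rewrite eq_sym (negbTE ji).
by rewrite eq_sym (negbTE ji).
Qed.

Lemma symp_term1 : symp_term 1 = 1.
Proof.
rewrite /symp_term odd_perm1 expr0 mul1r big1 // => i _; rewrite !perm1.
by rewrite (symp_pair i i false true) eqxx subr0.
Qed.

Lemma symp_term_pair_fixing s : (forall i b, exists c, s (op (i, b)) = op (i, c)) ->
  symp_term s = 1.
Proof.
have [m] := ubnP #|[pred i | s (ord_even i) != ord_even i]|.
elim: m s => // m IHm s lem sfix.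
case: (pickP (fun i => s (ord_even i) != ord_even i)) => [i si|s1].
  have [[] si0] := sfix i false; last by rewrite si0 eqxx in si.
  have [[] si1] := sfix i true.
    by have := perm_inj (etrans si0 (esym si1)) => /ord_pair_inj.
  rewrite -(symp_term_flip s i); apply: IHm => [|j b].
    rewrite -ltnS; apply: leq_trans lem; rewrite ltnS; apply/proper_card/properP.
    split; last by exists i => //; rewrite !inE permM tpermL si1 eqxx.
    apply/subsetP=> j; rewrite !inE permM; have [->|ji] := eqVneq j i.
      by rewrite si.
    rewrite tpermD //; first by rewrite (ord_pair_eq i j false false) eq_sym (negbTE ji).
    by rewrite (ord_pair_eq i j true false) andbF.
  rewrite permM; have [->|ji] := eqVneq j i.
    by case: b; [rewrite tpermR; exists true|rewrite tpermL; exists false].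
  rewrite tpermD //; first by rewrite (ord_pair_eq i j false b) eq_sym (negbTE ji).
  by rewrite (ord_pair_eq i j true b) eq_sym (negbTE ji).
suff -> : s = 1%g by exact: symp_term1.
apply/permP=> x; case: (ord_pairP t_even x) => i b ->; rewrite perm1.
have s0 : s (op (i, false)) = op (i, false) by have /negbFE/eqP := s1 i.
case: b => //.
have [[] //] := sfix i true.
by rewrite -[RHS]s0 => /perm_inj/ord_pair_inj.
Qed.

(** Only permutations that map blocks to blocks have a nonzero term. Permuting blocks and swapping
    inside blocks preserve the term and reduce such a permutation to the identity, whose term is
    1. *)
Lemma symp_term_bool s : exists b : bool, symp_term s = b%:R.
Proof.
have [sP|] := boolP (pair_preserving s); last first.
  move=> /forallPn[i /negbTE si]; exists false; rewrite /symp_term (bigD1 i) //=.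
  by rewrite {1}/symp si mul0r mulr0.
exists true; have ex i : exists j, forall b, exists c, s (op (i, b)) = op (j, c).
  have /forallP/(_ i) := sP.
  rewrite -[ord_even i]/(op (i, false)) -[ord_odd i]/(op (i, true)).
  case: (ord_pairP t_even (s (op (i, false)))) => j c e1.
  case: (ord_pairP t_even (s (op (i, true)))) => j' c' e2.
  rewrite e1 e2 !val_ord_pair !half_bit_double val_eqE => /eqP ej.
  by exists j; case; [exists c'; rewrite e2 ej|exists c].
pose pf i := sval (cid (ex i)).
have pfE i b : exists c, s (op (i, b)) = op (pf i, c) by exact: svalP (cid (ex i)) b.
have pf_inj : injective pf.
  move=> i j e; have [ci0 si0] := pfE i false; have [ci1 si1] := pfE i true.
  have [cj sj] := pfE j false.
  have ne : ci0 != ci1.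
    apply/eqP=> ec; have : s (op (i, false)) = s (op (i, true)) by rewrite si0 si1 ec.
    by move/perm_inj/ord_pair_inj.
  have [ec|] := eqVneq cj ci0.
    by have /perm_inj/ord_pair_inj[->] : s (op (i, false)) = s (op (j, false)) by rewrite si0 sj e ec.
  move=> ne'; have ec : cj = ci1 by case: (cj) (ci0) (ci1) ne ne' => [] [] [].
  by have /perm_inj/ord_pair_inj : s (op (i, true)) = s (op (j, false)) by rewrite si1 sj e ec.
pose p := perm pf_inj.
rewrite -(symp_term_lift s p^-1); apply: symp_term_pair_fixing => i b.
have [c sib] := pfE i b; exists c; rewrite permM sib pair_liftE.
by rewrite -[pf i](permE pf_inj) permK.
Qed.

(** No term is negative and the identity contributes 1, so nonvanishing in characteristic zero
    follows without counting permutations. *)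
Lemma pfaffian_sum_symp : exists N : nat, pfaffian_sum (symp_mx R t) = N.+1%:R.
Proof.
rewrite /pfaffian_sum.
under eq_bigr => s _.
  under eq_bigr do rewrite mxE.
  rewrite -/(symp_term s).
  over.
have /all_sig[b bE] s := cid (symp_term_bool s).
rewrite (bigD1 (1%g : 'S_t)) //= symp_term1.
under eq_bigr do rewrite bE.
by exists (\sum_(s : 'S_t | s != 1%g) b s)%N; rewrite -natr_sum mulrS.
Qed.

End SymplecticPfaffian.

(** * Nondegenerate skew-symmetric matrices in characteristic zero *)

Section SkewSymmetric.

Variable F : fieldType.
Hypothesis char0 : [pchar F] =i pred0.

Lemma char0_natf_eq0 m : (m%:R == 0 :> F) = (m == 0%N).
Proof. by move/pcharf0P: char0 => ->. Qed.

Lemma skew_diag0 m (A : 'M[F]_m) i : A^T = - A -> A i i = 0.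
Proof.
move=> /matrixP/(_ i i); rewrite !mxE => /eqP.
by rewrite -addr_eq0 -mulr2n -mulr_natl mulf_eq0 char0_natf_eq0 => /eqP.
Qed.

Lemma skew_congr m q (M : 'M[F]_(q, m)) (A : 'M[F]_m) :
  A^T = - A -> (M *m A *m M^T)^T = - (M *m A *m M^T).
Proof. by move=> AT; rewrite !trmx_mul trmxK AT mulNmx mulmxN mulmxA. Qed.

Lemma skew_unit_even m (A : 'M[F]_m) : A^T = - A -> A \in unitmx -> ~~ odd m.
Proof.
move=> AT Au; apply/negP=> m_odd; have := det_tr A.
rewrite AT -scaleN1r detZ -signr_odd m_odd expr1 mulN1r => /eqP.
rewrite eq_sym -addr_eq0 -mulr2n -mulr_natl mulf_eq0 char0_natf_eq0 /=.
by rewrite unitmxE unitfE in Au; rewrite (negbTE Au).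
Qed.

Lemma symp_mx_block m :
  symp_mx F (2 + m.*2) = block_mx (symp_mx F 2) 0 0 (symp_mx F m.*2).
Proof.
apply/matrixP=> i j; rewrite -[i]splitK -[j]splitK.
case: (split i) => i'; case: (split j) => j' /=; rewrite
  ?block_mxEul ?block_mxEur ?block_mxEdl ?block_mxEdr !mxE //= /symp /=.
- by case: i' => -[|[|?]].
- by case: j' => -[|[|?]].
- by rewrite !negbK eqSS.
Qed.

(** Symplectic Gram-Schmidt: a nonzero entry of the first row is moved to position (0, 1), the 2 x 2
    corner splits off, and the induction continues on the complementary block. *)
Lemma skew_congr_symp m (A : 'M[F]_(m.*2)) : A^T = - A -> A \in unitmx ->
  exists2 M, M \in unitmx & M *m A *m M^T = symp_mx F m.*2.
Proof.
elim: m A => [|m IHm] A AT Au.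
  by exists 1%:M; rewrite ?unitmx1 //; apply/matrixP=> -[].
rewrite doubleS -[(m.*2).+2]/(2 + m.*2)%N in A AT Au *.
pose i0 : 'I_(2 + m.*2) := lshift _ 0; pose i1 : 'I_(2 + m.*2) := lshift _ 1.
have [j A0j] : exists j, A i0 j != 0.
  apply: contrapT => /forallNP A0; move: Au; rewrite unitmxE unitfE (expand_det_row _ i0).
  by rewrite big1 ?eqxx // => j _; have /negP/negPn/eqP-> := A0 j; rewrite mul0r.
have j0 : j != i0 by apply: contraNneq A0j => ->; rewrite skew_diag0.
pose P : 'M[F]_(2 + m.*2) := perm_mx (tperm i1 j).
pose A1 := P *m A *m P^T.
have A1T : A1^T = - A1 by apply: skew_congr.
have A1u : A1 \in unitmx by rewrite !unitmx_mul Au unitmx_tr unitmx_perm.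
have A101 : A1 i0 i1 = A i0 j.
  by rewrite /A1 /P tr_perm_mx -row_permE -col_permE !mxE tpermL tpermD // eq_sym.
have [N Nu eN] : exists2 N, N \in unitmx & N *m A1 *m N^T = symp_mx F (2 + m.*2).
  have {A0j} x0 : A1 i0 i1 != 0 by rewrite A101.
  have [x ex] : exists x, A1 i0 i1 = x by exists (A1 i0 i1).
  rewrite ex in x0; clearbody A1 => {A101 P A AT Au j j0}.
  pose a := ulsubmx A1; pose b := ursubmx A1; pose d := dlsubmx A1; pose c := drsubmx A1.
  have eA1 : A1 = block_mx a b d c by rewrite submxK.
  have := A1T; rewrite eA1 tr_block_mx opp_block_mx => /eq_block_mx[aT dT bT cT].
  have ea : a = x *: symp_mx F 2.
    have a01 : a 0 1 = x by rewrite -ex mxE mxE; congr (A1 _ _); apply: val_inj.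
    have a10 : a 1 0 = - x by have := congr1 (fun M : 'M_2 => M 0 1) aT; rewrite mxE [RHS]mxE a01.
    apply/matrixP=> i j; rewrite [RHS]mxE [symp_mx _ _ _ _]mxE /symp.
    have [-> | ->] : i = 0 \/ i = 1 by case: i => -[|[|//]] ?; [left|right]; apply: val_inj.
      have [-> | ->] : j = 0 \/ j = 1 by case: j => -[|[|//]] ?; [left|right]; apply: val_inj.
        by rewrite (skew_diag0 0 aT) /= subr0 mulr0.
      by rewrite a01 /= subr0 mulr1.
    have [-> | ->] : j = 0 \/ j = 1 by case: j => -[|[|//]] ?; [left|right]; apply: val_inj.
      by rewrite a10 /= sub0r mulrN1.
    by rewrite (skew_diag0 1 aT) /= subrr mulr0.
  have J2 : symp_mx F 2 *m symp_mx F 2 = - 1%:M.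
    apply/matrixP=> i j; rewrite !mxE big_ord_recl big_ord1 !mxE /symp.
    by case: i => -[|[|//]] ilt; case: j => -[|[|//]] jlt /=; ring.
  (* Since [a] is [x] times a matrix of square -1, this is [- d] times the inverse of [a], the block
     that clears [d] and, by skew symmetry, [b]. *)
  pose E := d *m (x^-1 *: symp_mx F 2).
  have Ea : E *m a = - d.
    by rewrite /E ea -!mulmxA -scalemxAl -!scalemxAr scalerA mulVf // scale1r J2 mulmxN mulmx1.
  clearbody E; have aE : a *m E^T = - b.
    have -> : a *m E^T = - (E *m a)^T by rewrite trmx_mul aT mulNmx opprK.
    by rewrite Ea raddfN /= opprK dT.
  pose M2 : 'M[F]_(2 + m.*2) := block_mx 1%:M 0 E 1%:M.
  pose c' := E *m b + c.
  have eM2 : M2 *m A1 *m M2^T = block_mx a 0 0 c'.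
    rewrite /M2 eA1 mulmx_block tr_block_mx mulmx_block !trmx1 !trmx0.
    rewrite !mul1mx !mul0mx !mulmx1 !mulmx0 !addr0 Ea addNr !mul0mx add0r.
    by rewrite aE addNr.
  have M2u : M2 \in unitmx by rewrite unitmxE det_lblock !det1 mulr1 unitr1.
  have c'T : c'^T = - c'.
    have := skew_congr M2 A1T; rewrite eM2 tr_block_mx opp_block_mx.
    by case/eq_block_mx.
  have c'u : c' \in unitmx.
    have : block_mx a 0 0 c' \in unitmx by rewrite -eM2 !unitmx_mul M2u A1u unitmx_tr.
    by rewrite !unitmxE det_lblock unitrM => /andP[].
  have [N0 N0u eN0] := IHm c' c'T c'u.
  pose D : 'M[F]_2 := diag_mx (\row_i if i == 0 then x^-1 else 1).
  have eD : D *m a *m D^T = symp_mx F 2.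
    rewrite ea /D tr_diag_mx; apply/matrixP=> i j; rewrite mul_mx_diag mul_diag_mx !mxE /symp.
    case: i => -[|[|//]] ilt; case: j => -[|[|//]] jlt /=;
      rewrite ?subr0 ?sub0r ?subrr ?mulr0 ?mul0r ?mulr1 ?mul1r //.
    - by rewrite mulVf.
    - by rewrite mulrN1 mulNr mulfV.
  have Du : D \in unitmx.
    by rewrite unitmxE det_diag big_ord_recl big_ord1 !mxE /= mulr1 unitfE invr_neq0.
  exists (block_mx D 0 0 N0 *m M2).
    by rewrite unitmx_mul M2u unitmxE det_lblock unitrM -!unitmxE Du N0u.
  rewrite -eA1; have -> (B : 'M_(2 + m.*2)) :
      (B *m M2) *m A1 *m (B *m M2)^T = B *m (M2 *m A1 *m M2^T) *m B^T.
    by rewrite trmx_mul !mulmxA.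
  rewrite eM2.
  rewrite tr_block_mx !trmx0 !mulmx_block !(mulmx0, mul0mx, addr0, add0r) eD eN0.
  by rewrite symp_mx_block.
exists (N *m P); first by rewrite unitmx_mul Nu unitmx_perm.
by rewrite -eN /A1 trmx_mul !mulmxA.
Qed.

Lemma pfaffian_sum_unit t (A : 'M[F]_t) : A^T = - A -> A \in unitmx ->
  pfaffian_sum A != 0.
Proof.
move=> AT Au; have t_even := skew_unit_even AT Au.
have et : t = (t./2).*2 by rewrite even_halfK.
have [M Mu eM] : exists2 M, M \in unitmx & M *m A *m M^T = symp_mx F t.
  by move: A AT Au; rewrite et => A AT Au; apply: skew_congr_symp.
have [N eN] := pfaffian_sum_symp t_even F.
have := pfaffian_sum_congr t_even M A; rewrite eM eN => e.
apply: contraTneq (isT : true) => A0.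
by have /eqP := e; rewrite A0 mulr0 char0_natf_eq0.
Qed.

End SkewSymmetric.

(** * Pfaffian and Jacobian forms *)

Lemma map_pfaffian_sum (R S : comNzRingType) (phi : {rmorphism R -> S}) t (A : 'M[R]_t) :
  pfaffian_sum (map_mx phi A) = phi (pfaffian_sum A).
Proof.
rewrite rmorph_sum; apply: eq_bigr => s _; rewrite rmorphM rmorph_sign rmorph_prod.
by congr (_ * _); apply: eq_bigr => i _; rewrite mxE.
Qed.

Definition pf_form (R : comNzRingType) t n (B : 'M[R]_n) (W : 'M[R]_(t, n)) : R :=
  pfaffian_sum (W *m B *m W^T).

Definition jac_form (R : comNzRingType) r t (J : 'M[R]_(r, r + t)) (W : 'M[R]_(t, r + t)) : R :=
  \det (col_mx J W).

Lemma map_pf_form (R S : comNzRingType) (phi : {rmorphism R -> S}) t n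
    (B : 'M[R]_n) (W : 'M[R]_(t, n)) :
  pf_form (map_mx phi B) (map_mx phi W) = phi (pf_form B W).
Proof. by rewrite /pf_form -map_pfaffian_sum !map_mxM map_trmx. Qed.

Lemma map_jac_form (R S : comNzRingType) (phi : {rmorphism R -> S}) r t
    (J : 'M[R]_(r, r + t)) W :
  jac_form (map_mx phi J) (map_mx phi W) = phi (jac_form J W).
Proof. by rewrite /jac_form -det_map_mx map_col_mx. Qed.

Section Proportionality.

Variables (R : idomainType) (r t : nat) (t_even : ~~ odd t).
Variables (J : 'M[R]_(r, r + t)) (B : 'M[R]_(r + t)).
Hypotheses (BT : B^T = - B) (JB : J *m B = 0).

(** By Cramer's rule, [d *: W = X *m J + Y *m W0]. The part in [J] affects neither form, so both are
    governed by [\det Y]; the powers of [d] clear the denominators. *)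
Lemma kernel_form_proportional_aux (W W0 : 'M[R]_(t, r + t)) : jac_form J W0 != 0 ->
  pf_form B W * jac_form J W0 = pf_form B W0 * jac_form J W.
Proof.
rewrite /jac_form; set M0 := col_mx J W0; set d := \det M0 => d0.
pose X := lsubmx (W *m \adj M0); pose Y := rsubmx (W *m \adj M0).
have eW : d *: W = X *m J + Y *m W0.
  by rewrite -mul_row_col hsubmxK -mulmxA mul_adj_mx mul_mx_scalar.
have BJ : B *m J^T = 0.
  by apply: trmx_inj; rewrite trmx_mul trmxK BT mulmxN JB oppr0 trmx0.
have dt0 : d ^+ t != 0 by rewrite expf_neq0.
have ePf : d ^+ t * pf_form B W = \det Y * pf_form B W0.
  rewrite -[d ^+ t]det_scalar /pf_form -!pfaffian_sum_congr //; congr pfaffian_sum.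
  have -> (M : 'M[R]_t) (V : 'M[R]_(t, r + t)) :
      M *m (V *m B *m V^T) *m M^T = (M *m V) *m B *m (M *m V)^T.
    by rewrite trmx_mul !mulmxA.
  rewrite mul_scalar_mx eW mulmxDl -(mulmxA X) JB mulmx0 add0r.
  suff e : B *m (X *m J + Y *m W0)^T = B *m (Y *m W0)^T.
    by rewrite -mulmxA e trmx_mul !mulmxA.
  by rewrite raddfD /= mulmxDr (trmx_mul X) mulmxA BJ mul0mx add0r.
have eJ : d ^+ t * \det (col_mx J W) = \det Y * d.
  have <- : \det (block_mx 1%:M 0 X Y *m M0) = \det Y * d.
    by rewrite det_mulmx det_lblock det1 mul1r.
  have <- : \det (block_mx 1%:M 0 0 d%:M *m col_mx J W) = d ^+ t * \det (col_mx J W).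
    by rewrite det_mulmx det_lblock det1 mul1r det_scalar.
  rewrite !mul_block_col !mul1mx !mul0mx !addr0 add0r mul_scalar_mx.
  by rewrite -eW.
apply: (mulfI dt0); rewrite mulrA ePf mulrAC -eJ; ring.
Qed.

Lemma kernel_form_proportional (W W0 : 'M[R]_(t, r + t)) :
  pf_form B W * jac_form J W0 = pf_form B W0 * jac_form J W.
Proof.
have [J0|/kernel_form_proportional_aux//] := eqVneq (jac_form J W0) 0.
have [JW|/kernel_form_proportional_aux->//] := eqVneq (jac_form J W) 0.
by rewrite J0 JW !mulr0.
Qed.

End Proportionality.

(** * Derivations as ring morphisms modulo X^2 *)

Section DualNumbers.

Variable (S : comNzRingType).
Implicit Types (a b c d : {poly S}).

(* Congruence modulo X^2. *)
Definition eqX2 a b := a`_0 = b`_0 /\ a`_1 = b`_1.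

Lemma eqX2_refl a : eqX2 a a. Proof. by []. Qed.

Lemma eqX2_trans b a c : eqX2 a b -> eqX2 b c -> eqX2 a c.
Proof. by move=> [a0 a1] [b0 b1]; split; rewrite ?a0 ?a1. Qed.

Lemma eqX2D a b c d : eqX2 a b -> eqX2 c d -> eqX2 (a + c) (b + d).
Proof. by move=> [a0 a1] [c0 c1]; split; rewrite !coefD ?a0 ?a1 ?c0 ?c1. Qed.

Lemma eqX2M a b c d : eqX2 a b -> eqX2 c d -> eqX2 (a * c) (b * d).
Proof.
by move=> [a0 a1] [c0 c1]; split;
  rewrite !coefM !big_ord_recr !big_ord0 /= ?a0 ?a1 ?c0 ?c1.
Qed.

Lemma eqX2_sum (I : Type) (s : seq I) (P : pred I) (F G : I -> {poly S}) :
  (forall i, P i -> eqX2 (F i) (G i)) ->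
  eqX2 (\sum_(i <- s | P i) F i) (\sum_(i <- s | P i) G i).
Proof.
move=> FG; elim/big_rec2: _ => [|i x y Pi xy]; first exact: eqX2_refl.
by apply: eqX2D => //; apply: FG.
Qed.

Lemma eqX2_prod (I : Type) (s : seq I) (P : pred I) (F G : I -> {poly S}) :
  (forall i, P i -> eqX2 (F i) (G i)) ->
  eqX2 (\prod_(i <- s | P i) F i) (\prod_(i <- s | P i) G i).
Proof.
move=> FG; elim/big_rec2: _ => [|i x y Pi xy]; first exact: eqX2_refl.
by apply: eqX2M => //; apply: FG.
Qed.

Lemma eqX2_det t (A B : 'M[{poly S}]_t) :
  (forall i j, eqX2 (A i j) (B i j)) -> eqX2 (\det A) (\det B).
Proof.
move=> AB; apply: eqX2_sum => s _; apply: eqX2M; first exact: eqX2_refl.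
exact: eqX2_prod.
Qed.

Lemma eqX2_pfaffian_sum t (A B : 'M[{poly S}]_t) :
  (forall i j, eqX2 (A i j) (B i j)) -> eqX2 (pfaffian_sum A) (pfaffian_sum B).
Proof.
move=> AB; apply: eqX2_sum => s _; apply: eqX2M; first exact: eqX2_refl.
exact: eqX2_prod.
Qed.

(** A permutation other than the identity moves some [i] and also its image, and each contributes a
    factor ['X]; modulo ['X^2] only the diagonal product survives. *)
Lemma eqX2_det1D t (A : 'M[S]_t) :
  eqX2 (\det (1%:M + 'X *: map_mx polyC A)) (1 + (\tr A)%:P * 'X).
Proof.
rewrite /determinant (bigD1 (1%g : 'S_t)) //= odd_perm1 expr0 mul1r -[X in eqX2 _ X]addr0.
apply: eqX2D.
  apply: (big_ind2 (fun x y => eqX2 x (1 + y%:P * 'X))) => [|x1 x2 y1 y2 xy1 xy2|i _].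
  - by rewrite mul0r addr0.
  - apply: (eqX2_trans (eqX2M xy1 xy2)); split; rewrite ?coefM;
    rewrite !big_ord_recr !big_ord0 /= !coefD !coef1 !coefMX !coefC /= ?coefD; ring.
  - by rewrite perm1 !mxE eqxx mulrC.
apply: (@eqX2_trans (\sum_(s : 'S_t | s != 1%g) 0)); last by rewrite big1.
apply: eqX2_sum => s s1.
have [i si] : exists i, s i != i.
  apply/existsP; apply: contraNT s1 => /existsPn h.
  by apply/eqP/permP=> i; rewrite perm1; apply/eqP/negbNE/h.
have ssi : s (s i) != s i by rewrite (inj_eq perm_inj).
rewrite (bigD1 i) //= (bigD1 (s i)) //= !mxE eq_sym (negbTE si) [s i == _]eq_sym (negbTE ssi) !add0r.
have E (u x y w z : {poly S}) : eqX2 (u * (z * x * (z * y * w))) ((u * x * y * w) * z ^+ 2).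
  by rewrite (_ : u * _ = (u * x * y * w) * z ^+ 2) //; ring.
by apply: (eqX2_trans (E _ _ _ _ _)); split; rewrite coefMXn coef0.
Qed.

End DualNumbers.

Section Derivation.

Variables (S : comNzRingType) (D : S -> S).
Hypotheses (D_zmod : zmod_morphism D)
  (D_mul : forall a b, D (a * b) = D a * b + a * D b).

Let D0 : D 0 = 0. Proof. by rewrite -[in LHS](subrr 0) D_zmod subrr. Qed.
Let DN a : D (- a) = - D a. Proof. by rewrite -[in LHS]sub0r D_zmod D0 sub0r. Qed.
Let DD a b : D (a + b) = D a + D b.
Proof. by rewrite -[b in LHS]opprK D_zmod DN opprK. Qed.
Let D1 : D 1 = 0.
Proof. by apply: (addIr (D 1)); rewrite add0r -[in RHS](mulr1 1) D_mul mulr1 mul1r. Qed.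

(* The ring morphism S -> S[X]/(X^2) attached to the derivation D. *)
Definition dual_map (a : S) : {poly S} := a%:P + (D a)%:P * 'X.

Lemma dual_map0E a : (dual_map a)`_0 = a.
Proof. by rewrite coefD coefC coefMX addr0. Qed.

Lemma dual_map1E a : (dual_map a)`_1 = D a.
Proof. by rewrite coefD !coefC coefMX coefC add0r. Qed.

Lemma dual_mapM a b : eqX2 (dual_map (a * b)) (dual_map a * dual_map b).
Proof.
split; rewrite coefM !big_ord_recr !big_ord0 /= ?subn0 ?subnn ?dual_map0E ?dual_map1E ?D_mul; ring.
Qed.

Lemma dual_map_sum (I : Type) (s : seq I) (P : pred I) (F : I -> S) (G : I -> {poly S}) :
  (forall i, P i -> eqX2 (dual_map (F i)) (G i)) ->
  eqX2 (dual_map (\sum_(i <- s | P i) F i)) (\sum_(i <- s | P i) G i).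
Proof.
move=> FG; apply: (big_ind2 (fun x y => eqX2 (dual_map x) y)) => //.
  by split; rewrite ?dual_map0E ?dual_map1E ?D0 coef0.
move=> x1 x2 y1 y2 xy1 xy2; apply: eqX2_trans (eqX2D xy1 xy2).
split; first by rewrite coefD !dual_map0E.
by rewrite coefD !dual_map1E DD.
Qed.

Lemma dual_map_prod (I : Type) (s : seq I) (P : pred I) (F : I -> S) (G : I -> {poly S}) :
  (forall i, P i -> eqX2 (dual_map (F i)) (G i)) ->
  eqX2 (dual_map (\prod_(i <- s | P i) F i)) (\prod_(i <- s | P i) G i).
Proof.
move=> FG; apply: (big_ind2 (fun x y => eqX2 (dual_map x) y)) => //.
  by split; rewrite ?dual_map0E ?dual_map1E ?D1 coef1.
move=> x1 x2 y1 y2 xy1 xy2; apply: eqX2_trans (eqX2M xy1 xy2).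
exact: dual_mapM.
Qed.

Lemma dual_map_sign (b : bool) a G :
  eqX2 (dual_map a) G -> eqX2 (dual_map ((-1) ^+ b * a)) ((-1) ^+ b * G).
Proof.
move=> [aG0 aG1]; case: b; rewrite ?expr0 ?mul1r // expr1 !mulN1r.
by split; rewrite coefN -?aG0 -?aG1 ?dual_map0E ?dual_map1E ?DN.
Qed.

Lemma dual_map_det t (M : 'M[S]_t) (N : 'M[{poly S}]_t) :
  (forall i j, eqX2 (dual_map (M i j)) (N i j)) -> eqX2 (dual_map (\det M)) (\det N).
Proof.
by move=> MN; apply: dual_map_sum => s _; apply/dual_map_sign/dual_map_prod.
Qed.

Lemma dual_map_pfaffian_sum t (M : 'M[S]_t) (N : 'M[{poly S}]_t) :
  (forall i j, eqX2 (dual_map (M i j)) (N i j)) ->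
  eqX2 (dual_map (pfaffian_sum M)) (pfaffian_sum N).
Proof.
by move=> MN; apply: dual_map_sum => s _; apply/dual_map_sign/dual_map_prod.
Qed.

Lemma dual_map_mulmx m1 m2 m3 (M : 'M[S]_(m1, m2)) (N : 'M[S]_(m2, m3))
    (M' : 'M[{poly S}]_(m1, m2)) (N' : 'M[{poly S}]_(m2, m3)) :
  (forall i j, eqX2 (dual_map (M i j)) (M' i j)) ->
  (forall i j, eqX2 (dual_map (N i j)) (N' i j)) ->
  forall i j, eqX2 (dual_map ((M *m N) i j)) ((M' *m N') i j).
Proof.
move=> MM NN i j; rewrite !mxE; apply: dual_map_sum => l _.
by apply: (eqX2_trans (dual_mapM _ _)); apply: eqX2M.
Qed.

Lemma dual_map_const a : D a = 0 -> dual_map a = a%:P.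
Proof. by rewrite /dual_map => ->; rewrite polyC0 mul0r addr0. Qed.

End Derivation.

(** * Invariance of the ratio of the two forms *)

Section Invariance.

Variables (S : idomainType) (D : S -> S).
Hypotheses (D_zmod : zmod_morphism D)
  (D_mul : forall a b, D (a * b) = D a * b + a * D b).
Variables (r t : nat) (t_even : ~~ odd t).
Variables (J : 'M[S]_(r, r + t)) (B A : 'M[S]_(r + t)) (W : 'M[S]_(t, r + t)) (p q : S).
Hypotheses (BT : B^T = - B) (JB : J *m B = 0).
Hypothesis DJ : map_mx D J = - (J *m A).
Hypothesis DB : map_mx D B = A *m B + B *m A^T.
Hypothesis DW : map_mx D W = 0.
Hypotheses (trA : \tr A = 0) (Dp : D p = 0).
Hypotheses (pf0 : pf_form B W != 0) (epq : p * jac_form J W = q * pf_form B W).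

Local Notation "M ^P" := (map_mx polyC M) (at level 2, format "M ^P").
Let A1 : 'M[{poly S}]_(r + t) := 1%:M + 'X *: A^P.

Let dualW i j : eqX2 (dual_map D (W i j)) (W^P i j).
Proof.
by rewrite dual_map_const ?mxE //; have /matrixP/(_ i j) := DW; rewrite !mxE.
Qed.

(** The cross-product identity holds over [{poly S}] as well; it carries the relation from [W] to
    the deformed argument after cancelling [pf_form B W]. *)
Let proportional (V : 'M[{poly S}]_(t, r + t)) :
  p%:P * jac_form J^P V = q%:P * pf_form B^P V.
Proof.
have BTP : (B^P)^T = - B^P by rewrite map_trmx BT map_mxN.
have JBP : J^P *m B^P = 0 by rewrite -map_mxM JB map_mx0.
have := kernel_form_proportional t_even BTP JBP V W^P.
rewrite map_pf_form map_jac_form => e.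
have c0 : (pf_form B W)%:P != 0 by rewrite polyC_eq0.
apply: (mulfI c0); rewrite mulrCA -e mulrCA -polyCM epq polyCM; ring.
Qed.

(** By [DB], the deformation of [B] is [A1 *m B *m A1^T] modulo ['X^2]; moving [A1] onto [W] leaves
    [B] undeformed. *)
Let dual_pf : eqX2 (dual_map D (pf_form B W)) (pf_form B^P (W^P *m A1)).
Proof.
rewrite /pf_form.
have -> : W^P *m A1 *m B^P *m (W^P *m A1)^T = W^P *m (A1 *m B^P *m A1^T) *m (W^P)^T.
  by rewrite trmx_mul !mulmxA.
apply: (dual_map_pfaffian_sum D_zmod D_mul); apply: (dual_map_mulmx D_zmod D_mul); last first.
  by move=> i j; rewrite !mxE; have := dualW j i; rewrite mxE.
apply: (dual_map_mulmx D_zmod D_mul) => // i j.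
have -> : A1 *m B^P *m A1^T =
    B^P + 'X *: (A *m B + B *m A^T)^P + 'X^2 *: (A *m B *m A^T)^P.
  rewrite /A1 linearD /= linearZ /= trmx1 map_trmx.
  rewrite mulmxDl mul1mx -scalemxAl mulmxDr mulmx1 -scalemxAr mulmxDl -scalemxAl.
  by rewrite scalerDr scalerA -expr2 !map_mxD !map_mxM scalerDr -!addrA; congr (_ + _); rewrite addrCA.
rewrite -DB !mxE; split.
  by rewrite dual_map0E !coefD coefXM coefXnM coefC /= !addr0.
by rewrite dual_map1E !coefD coefXM coefXnM !coefC /= addr0 add0r.
Qed.

(** By [DJ], the deformation of [J] is [J *m A2], where [A2] is inverse to [A1] modulo ['X^2].
    Multiplying on the right by [A1], whose determinant is 1 modulo ['X^2] because the trace
    vanishes, shifts the deformation to [W]. *)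
Let dual_jac : eqX2 (dual_map D (jac_form J W)) (jac_form J^P (W^P *m A1)).
Proof.
pose A2 : 'M[{poly S}]_(r + t) := 1%:M - 'X *: A^P.
apply: (@eqX2_trans _ (\det (col_mx (J^P *m A2) W^P))).
  apply: (dual_map_det D_zmod D_mul) => i j; rewrite -[i]splitK.
  case: (split i) => i' /=; rewrite ?col_mxEu ?col_mxEd //.
  rewrite /A2 mulmxBr mulmx1 -scalemxAr -map_mxM !mxE.
  have /matrixP/(_ i' j) := DJ; rewrite !mxE => DJij.
  by split; rewrite ?dual_map0E ?dual_map1E coefB coefXM !coefC /= ?subr0 // DJij sub0r.
apply: (@eqX2_trans _ (\det (col_mx (J^P *m A2) W^P) * \det A1)).
  rewrite -[X in eqX2 X]mulr1; apply: eqX2M; first exact: eqX2_refl.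
  have [d0 d1] := eqX2_det1D A.
  by split; rewrite ?d0 ?d1 trA polyC0 mul0r addr0.
rewrite -det_mulmx mul_col_mx -mulmxA.
have -> : A2 *m A1 = 1%:M - 'X^2 *: (A *m A)^P.
  rewrite /A2 /A1 mulmxBl mul1mx mulmxDr mulmx1 -scalemxAl -scalemxAr scalerA -expr2 map_mxM.
  by rewrite opprD addrA addrK.
apply: eqX2_det => i j; rewrite -[i]splitK.
case: (split i) => i' /=; rewrite ?col_mxEu ?col_mxEd //.
rewrite mulmxBr mulmx1 -scalemxAr !mxE.
by split; rewrite coefB coefXnM /= subr0.
Qed.

(** The deformed forms still satisfy the relation with undeformed [p] and [q]; comparing
    coefficients of ['X] leaves [D q * pf_form B W = 0]. *)
Lemma derivation_ratio_eq0 : D q = 0.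
Proof.
have := eqX2_trans (dual_mapM D_mul p (jac_form J W)) (eqX2M (eqX2_refl _) dual_jac).
rewrite (dual_map_const Dp) proportional epq => e.
have [q0 q1] := eqX2M (eqX2_refl q%:P) dual_pf.
have [e0 e1] := dual_mapM D_mul q (pf_form B W).
have [] := e; rewrite e0 e1 -q0 -q1 => _.
rewrite !coefM !big_ord_recr !big_ord0 /= !dual_map0E !dual_map1E !coefC /= !add0r !mul0r addr0.
move/eqP; rewrite -subr_eq0 addrC addrK mulf_eq0 (negbTE pf0) orbF.
by move/eqP.
Qed.

End Invariance.

Section GcdRatio.

Variables (S : idomainType) (fS : factorial_ring S).

(* If the vectors (P i) and (Q i) are proportional and p is a gcd of the P i,
   then the ratio of (Q i) to (P i / p) lies in S. *)
Lemma gcd_ratio (I : Type) (P Q : I -> S) (p : S) :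
  (exists i, P i != 0) ->
  (forall i, rdvd p (P i)) -> (forall c, (forall i, rdvd c (P i)) -> rdvd c p) ->
  (forall i j, P i * Q j = P j * Q i) ->
  exists q, forall i, p * Q i = q * P i.
Proof.
move=> [i0 Pi0] pP pmax PQ.
have {pP}[P' eP] : exists P', forall i, P i = P' i * p.
  by exists (fun i => sval (cid (pP i))) => i; case: cid.
have p0 : p != 0 by apply: contraNneq Pi0 => p0; rewrite eP p0 mulr0.
have P'0 : P' i0 != 0 by apply: contraNneq Pi0 => P0; rewrite eP P0 mul0r.
have [||q eq] := rdvd_coprime_family (F := P') (b := Q i0) fS P'0.
- move=> v [v0 v1 _] vP'; apply: v1.
  have [|c ec] := pmax (v * p); last first.
    by exists c; apply: (mulIf p0); rewrite mul1r {1}ec mulrA.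
  by move=> i; rewrite eP; apply: rdvd_mul => //; apply: rdvd_refl.
- move=> i; exists (Q i); apply: (mulIf p0); rewrite -mulrA -eP mulrC PQ eP; ring.
exists q => i; apply: (mulfI Pi0).
have := PQ i0 i; rewrite eq !eP => e.
by rewrite mulrCA e; ring.
Qed.

End GcdRatio.

(** * Algebraic independence and Jacobians *)

Section MpolyComposition.

Variable k : fieldType.

Lemma mpoly_ring_ind n (P : {mpoly k[n]} -> Prop) :
  (forall c, P c%:MP) -> (forall i, P 'X_i) ->
  (forall p q, P p -> P q -> P (p + q)) -> (forall p q, P p -> P q -> P (p * q)) ->
  forall p, P p.
Proof.
move=> PC PX PD PM p; rewrite (mpolyE p).
apply: big_ind => [|//|m _]; first by rewrite -mpolyC0.
rewrite -mul_mpolyC; apply: (PM) => //; rewrite mpolyXE_id.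
apply: big_ind => [|//|i _]; first by rewrite -mpolyC1.
by elim: (m i) => [|e IHe]; rewrite ?expr0 -?mpolyC1 // exprS; apply: PM.
Qed.

Lemma comp_mpolyXi n m i (g : n.-tuple {mpoly k[m]}) : 'X_i \mPo g = tnth g i.
Proof. by rewrite comp_mpolyXU -tnth_nth. Qed.

Lemma comp_mpolyM n m (g : n.-tuple {mpoly k[m]}) p q :
  (p * q) \mPo g = (p \mPo g) * (q \mPo g).
Proof. exact: rmorphM. Qed.

Lemma comp_mpolyA n m l (t : n.-tuple {mpoly k[m]}) (g : m.-tuple {mpoly k[l]}) H :
  (H \mPo t) \mPo g = H \mPo [tuple tnth t i \mPo g | i < n].
Proof.
elim/mpoly_ring_ind: H => [c|i|p q ep eq|p q ep eq].
- by rewrite !comp_mpolyC.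
- by rewrite !comp_mpolyXi tnth_mktuple.
- by rewrite !comp_mpolyD ep eq.
- by rewrite !comp_mpolyM ep eq.
Qed.

Lemma mderiv_comp n m (g : n.-tuple {mpoly k[m]}) H l :
  (H \mPo g)^`M(l) = \sum_i (H^`M(i) \mPo g) * (tnth g i)^`M(l).
Proof.
elim/mpoly_ring_ind: H => [c|i|p q ep eq|p q ep eq].
- by rewrite comp_mpolyC mderivC big1 // => i _; rewrite mderivC comp_mpoly0 mul0r.
- rewrite comp_mpolyXi (bigD1 i) //= big1 ?addr0 => [|j ji].
    have UU : (U_(i) - U_(i))%MM = 0%MM by apply/mnmP=> j; rewrite mnmBE subnn mnm0E.
    by rewrite mderivX mnm1E eqxx scale1r UU mpolyX0 comp_mpoly1 mul1r.
  by rewrite mderivX mnm1E eq_sym (negbTE ji) scale0r comp_mpoly0 mul0r.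
- by rewrite comp_mpolyD mderivD ep eq -big_split; apply: eq_bigr => i _; rewrite mderivD comp_mpolyD mulrDl.
- rewrite comp_mpolyM mderivM ep eq mulr_suml mulr_sumr -big_split; apply: eq_bigr => i _ /=.
  by rewrite mderivM comp_mpolyD !comp_mpolyM; ring.
Qed.

(** A vanishing derivative stands for not involving ['X_i]; the two agree in characteristic zero. *)
Lemma mpoly_split_var n (i : 'I_n) (H : {mpoly k[n]}) :
  exists K H0 : {mpoly k[n]}, H = 'X_i * K + H0 /\ H0^`M(i) = 0.
Proof.
elim/mpoly_ring_ind: H => [c|j|p q [K [H [-> dH]]] [L [G [-> dG]]]|p q [K [H [-> dH]]] [L [G [-> dG]]]].
- by exists 0, c%:MP; rewrite mulr0 add0r mderivC.
- have [->|ji] := eqVneq j i; first by exists 1, 0; rewrite mulr1 addr0 mderiv0.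
  by exists 0, 'X_j; rewrite mulr0 add0r mderivX mnm1E (negbTE ji) scale0r.
- exists (K + L), (H + G); rewrite mderivD dH dG addr0; split=> //; ring.
- exists ('X_i * K * L + K * G + H * L), (H * G); rewrite mderivM dH dG mul0r mulr0 addr0.
  by split=> //; ring.
Qed.

Hypothesis char0 : [pchar k] =i pred0.

Lemma mderiv_eq0_msupp n (i : 'I_n) (H : {mpoly k[n]}) m :
  H^`M(i) = 0 -> m \in msupp H -> m i = 0%N.
Proof.
move=> dH; rewrite mcoeff_msupp; apply: contraNeq; rewrite -lt0n => mi.
have := mcoeff_mderiv i H (m - U_(i))%MM; rewrite dH mcoeff0.
have -> : (m - U_(i) + U_(i) = m)%MM.
  by apply/mnmP=> j; rewrite mnmDE mnmBE mnm1E; case: eqVneq => [<-|_]; rewrite ?subnK // subn0 addn0.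
move/esym/eqP; rewrite -mulr_natr mulf_eq0.
by move/pcharf0P: char0 => ->; rewrite orbF.
Qed.

Lemma comp_mpoly_eq_off n m (g h : n.-tuple {mpoly k[m]}) (i : 'I_n) H :
  H^`M(i) = 0 -> (forall l, l != i -> tnth g l = tnth h l) -> H \mPo g = H \mPo h.
Proof.
move=> dH gh; rewrite !comp_mpolyEX; apply: eq_big_seq => a aH.
rewrite !comp_mpolyX; congr (_ *: _); apply: eq_bigr => l _.
have [->|li] := eqVneq l i; last by rewrite gh.
by rewrite (mderiv_eq0_msupp dH aH) !expr0.
Qed.

Lemma mderiv_msize n (i : 'I_n) (H : {mpoly k[n]}) : H^`M(i) != 0 ->
  (msize H^`M(i) < msize H)%N.
Proof.
move=> d0; rewrite -(mlead_deg d0) -ltnS.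
have : mlead H^`M(i) \in msupp H^`M(i) by rewrite mlead_supp.
rewrite mcoeff_msupp mcoeff_mderiv => c0.
have : (mlead H^`M(i) + U_(i))%MM \in msupp H.
  by rewrite mcoeff_msupp; apply: contraNneq c0 => ->; rewrite mul0rn.
by move/msize_mdeg_lt; rewrite mdegD mdeg1 addn1.
Qed.

End MpolyComposition.

Section TranscendenceBound.

Variable k : fieldType.

Lemma msize_mul_le n (p q : {mpoly k[n]}) d e :
  (msize p <= d.+1)%N -> (msize q <= e.+1)%N -> (msize (p * q) <= (d + e).+1)%N.
Proof.
have [->|p0] := eqVneq p 0; first by rewrite mul0r msize0.
have [->|q0] := eqVneq q 0; first by rewrite mulr0 msize0.
by rewrite msizeM // (mpolySpred _ p0) (mpolySpred _ q0) !ltnS addSn addnS; apply: leq_add.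
Qed.

Lemma msize_exp_le n (p : {mpoly k[n]}) d e :
  (msize p <= d.+1)%N -> (msize (p ^+ e) <= (e * d).+1)%N.
Proof.
move=> pd; elim: e => [|e IHe]; first by rewrite expr0 msize1.
by rewrite exprS mulSn; apply: msize_mul_le.
Qed.

(** Dimension count: if [n < r], the monomials in [f] with exponents below [N] outnumber the
    monomials in [n] variables with exponents at most [D], and a linear relation between the former
    is an algebraic relation for [f]. *)
Lemma alg_independent_size n r (f : r.-tuple {mpoly k[n]}) : alg_independent f -> (r <= n)%N.
Proof.
move=> f_ind; rewrite leqNgt; apply/negP => nr.
pose e := (\max_i msize (tnth f i))%N.
(* Here [D + 1 <= c * N], so [(D + 1)^n <= c^n * N^n < N^(n + 1) <= N^r]. *)
pose c := (r * e).+1; pose N := (c ^ n).+1; pose D := (r * e * N)%N.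
pose mon (phi : {ffun 'I_r -> 'I_N}) : 'X_{1..r} := [multinom (phi i : nat) | i < r].
pose mon' (psi : {ffun 'I_n -> 'I_D.+1}) : 'X_{1..n} := [multinom (psi i : nat) | i < n].
pose M : 'M[k]_(#|{ffun 'I_r -> 'I_N}|, #|{ffun 'I_n -> 'I_D.+1}|) :=
  \matrix_(a, b) ('X_[mon (enum_val a)] \mPo f)@_(mon' (enum_val b)).
have ltM : (#|{ffun 'I_n -> 'I_D.+1}| < #|{ffun 'I_r -> 'I_N}|)%N.
  rewrite !card_ffun !card_ord.
  apply: (@leq_trans (N ^ n.+1)); last exact: leq_pexp2l.
  apply: (@leq_ltn_trans ((c * N) ^ n)).
    by case: (n) => // n'; rewrite leq_exp2r // /c mulSn -[D.+1]add1n leq_add2r.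
  by rewrite expnMn expnS ltn_pmul2r // expn_gt0.
have [u u0 uM] : exists2 u : 'rV_(_), u != 0 & u *m M = 0.
  have : kermx M != 0.
    rewrite -mxrank_eq0 mxrank_ker subn_eq0 -ltnNge.
    exact: leq_ltn_trans (rank_leq_col _) ltM.
  by case/rowV0Pn => u /sub_kermxP uM u0; exists u.
pose H := \sum_a u 0 a *: 'X_[mon (enum_val a)].
have mon_inj : injective mon.
  move=> a b /mnmP eab; apply/ffunP=> i; apply: val_inj.
  by have := eab i; rewrite !mnmE.
case/eqP: u0; apply/rowP=> a; rewrite [RHS]mxE.
have <- : H@_(mon (enum_val a)) = u 0 a.
  rewrite raddf_sum (bigD1 a) //= big1 ?addr0 => [|b ba]; rewrite mcoeffZ mcoeffX ?eqxx ?mulr1 //.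
  by rewrite (inj_eq mon_inj) (inj_eq enum_val_inj) (negbTE ba) mulr0.
rewrite (f_ind H) ?mcoeff0 //; apply/mpolyP=> m; rewrite mcoeff0 (raddf_sum (comp_mpoly f)) (raddf_sum (mcoeff m)) /=.
have szX (b : 'I_#|{ffun 'I_r -> 'I_N}|) : (msize ('X_[mon (enum_val b)] \mPo f) <= D.+1)%N.
  rewrite comp_mpolyX; apply: (@leq_trans (\sum_(i < r) e * N)%N.+1).
    elim/big_rec2: _ => [|i y z _ le]; first by rewrite msize1.
    have pe : (msize (tnth f i) <= e.+1)%N by apply: leqW; rewrite /e (bigmax_sup i).
    apply: leq_trans (msize_mul_le (msize_exp_le _ pe) le) _.
    by rewrite ltnS leq_add2r mulnC leq_mul2l mnmE ltnW ?orbT.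
  by rewrite sum_nat_const card_ord mulnA.
have [mD|mD] := leqP D.+1 (mdeg m).
  rewrite big1 // => b _; rewrite comp_mpolyZ mcoeffZ [_@_m]memN_msupp_eq0 ?mulr0 //.
  by apply: msize_mdeg_ge; rewrite (leq_trans (szX b)) // mD.
have mi i : (m i < D.+1)%N.
  by apply: leq_ltn_trans mD; rewrite mdegE (bigD1 i) //= leq_addr.
pose psi := [ffun i => Ordinal (mi i)].
have em : m = mon' psi by apply/mnmP=> i; rewrite mnmE ffunE.
have /rowP/(_ (enum_rank psi)) := uM; rewrite !mxE => e0; rewrite -[RHS]e0.
by apply: eq_bigr => b _; rewrite comp_mpolyZ mcoeffZ !mxE enum_rankK -em.
Qed.

End TranscendenceBound.

Section DetCongruence.

Variables (R : idomainType) (v : R).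

Lemma rdvd_det_sub m (A B : 'M[R]_m) :
  (forall i j, rdvd v (A i j - B i j)) -> rdvd v (\det A - \det B).
Proof.
move=> AB; have mulB a b c d : rdvd v (a - b) -> rdvd v (c - d) -> rdvd v (a * c - b * d).
  move=> ab cd; rewrite (_ : _ - _ = (a - b) * c + b * (c - d)); last by ring.
  by apply: rdvdD; [apply: rdvd_mulr|apply: rdvd_mull].
rewrite /determinant -sumrB; apply: rdvd_sum => s _; apply: (mulB).
  by rewrite subrr; apply: rdvdr0.
apply: (big_ind2 (fun x y => rdvd v (x - y))) => [|x1 x2 y1 y2 xy1 xy2|//].
  by rewrite subrr; apply: rdvdr0.
exact: mulB.
Qed.

End DetCongruence.

(** * The Jacobian criterion modulo a prime *)

Section JacobianCriterion.

Variables (k : fieldType) (char0 : [pchar k] =i pred0) (n : nat).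
Local Notation S := {mpoly k[n]}.
Implicit Types (v : S) (s : seq S).

(** Rows past the end of [s] vanish, by the default value of [nth]; the matrix is thus square for
    lists of any length, and singular for short ones. *)
Definition jacobian s : 'M[S]_n := \matrix_(i, m) (s`_i)^`M(m).

Variables (v : S) (mark : option nat).
Hypothesis vM : forall a b, rdvd v (a * b) -> rdvd v a \/ rdvd v b.
Hypothesis v1 : ~ rdvd v 1.

Definition unmarked d (H : {mpoly k[d]}) : Prop :=
  forall i : 'I_d, mark = Some (val i) -> H^`M(i) = 0.

(* Algebraic independence modulo v of the components of g other than the
   marked one. *)
Definition independent_mod d (g : d.-tuple S) : Prop :=
  forall H : {mpoly k[d]}, unmarked H -> rdvd v (H \mPo g) -> H = 0.

(** Either [v = 0] with no mark, which is ordinary algebraic independence, or [v] itself sits at the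
    marked place, as a coordinate transversal to the hypersurface [v = 0]. *)
Definition marked_tuple d (g : d.-tuple S) : Prop :=
  (mark = None /\ v = 0) \/
  (v != 0 /\ exists2 i : 'I_d, mark = Some (val i) & tnth g i = v).

(** With a mark, [g] is algebraically independent: in a relation [H], the part free of the marked
    variable is a relation modulo [v], hence zero; dividing the rest by [v] gives a relation of
    smaller degree. *)
Lemma independent_mod_size d (g : d.-tuple S) :
  marked_tuple g -> independent_mod g -> (d <= n)%N.
Proof.
move=> gm gI; apply: (@alg_independent_size k n d g) => H Hg.
case: gm => [[mN _]|[v0 [i mi gi]]].
  by apply: gI => [i|]; [rewrite mN|rewrite Hg; apply: rdvdr0].
have [m] := ubnP (msize H); elim: m H Hg => // m IHm H Hg Hm.
have [K [H0 [eH dH0]]] := mpoly_split_var i H.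
have H00 : H0 = 0.
  apply: gI => [l|]; first by rewrite mi => -[/val_inj <-].
  exists (- (K \mPo g)); move: Hg; rewrite eH comp_mpolyD comp_mpolyM comp_mpolyXi gi.
  by rewrite addrC => /eqP; rewrite addr_eq0 => /eqP ->; rewrite mulrC mulNr.
rewrite {}H00 addr0 in eH; have [K0|K0] := eqVneq K 0; first by rewrite eH K0 mulr0.
suff K00 : K = 0 by rewrite eH K00 mulr0.
apply: IHm.
  move: Hg; rewrite eH comp_mpolyM comp_mpolyXi gi => /eqP.
  by rewrite mulf_eq0 (negbTE v0) => /eqP.
have sX : msize ('X_i : {mpoly k[d]}) = 2 by rewrite msizeX mdeg1.
have X0 : 'X_i != 0 :> {mpoly k[d]} by rewrite -msize_poly_eq0 sX.
by move: Hm; rewrite eH msizeM // sX !addSn /= add0n ltnS.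
Qed.

(* If H is a polynomial relation modulo v, of least degree, satisfied by g and
   'X_l, then differentiating it expresses dX_l in terms of the dg_i. *)
Lemma relation_of_dependent d (g : d.-tuple S) (l : 'I_n) :
  marked_tuple g -> independent_mod g ->
  ~ independent_mod [tuple of rcons g 'X_l] ->
  exists T (c : nat -> S), ~ rdvd v T /\
    forall m, rdvd v ((l == m)%:R * T - \sum_(i < d) c i * (tnth g i)^`M(m)).
Proof.
move=> gm gI; set g' := [tuple of rcons g 'X_l] => gD.
have g'w (i : 'I_d) : tnth g' (widen_ord (leqnSn d) i) = tnth g i.
  by rewrite !(tnth_nth 0) /= nth_rcons size_tuple ltn_ord.
have g'l : tnth g' ord_max = 'X_l.
  by rewrite (tnth_nth 0) /= nth_rcons size_tuple ltnn eqxx.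
pose rel H := [/\ unmarked H, rdvd v (H \mPo g') & H != 0].
have exH : exists m, `[< exists H, rel H /\ msize H = m >].
  have /existsNP[H /not_implyP[Hu /not_implyP[Hv /eqP H0]]] := gD.
  by exists (msize H); apply/asboolP; exists H.
case: (ex_minnP exH) => _ /asboolP[H [[Hu [w Hw] H0] <-]] Hmin.
(* Otherwise [H] would involve only the variables of [g] and be a relation modulo [v] for [g]
   itself. *)
have d0 : H^`M(ord_max) != 0.
  apply/eqP=> dH.
  pose t : d.+1.-tuple {mpoly k[d]} :=
    [tuple if insub (i : nat) is Some j then 'X_j else 0 | i < d.+1].
  have tw (i : 'I_d) : tnth t (widen_ord (leqnSn d) i) = 'X_i.
    by rewrite tnth_mktuple; case: insubP => [j _ /val_inj ->|]; rewrite //= ltn_ord.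
  have tm : tnth t ord_max = 0 by rewrite tnth_mktuple insubF //= ltnn.
  have maxP (i : 'I_d.+1) : i != ord_max -> exists j : 'I_d, i = widen_ord (leqnSn d) j.
    move=> im; have id : (i < d)%N.
      by have := ltn_ord i; rewrite ltnS leq_eqVlt -val_eqE in im *; rewrite (negbTE im).
    by exists (Ordinal id); apply: val_inj.
  case/eqP: H0; pose H' := H \mPo t.
  have H'0 : H' = 0.
    apply: gI => [i mi|].
      rewrite mderiv_comp big1 // => a _.
      have [->|/maxP[j ->]] := eqVneq a ord_max; first by rewrite dH comp_mpoly0 mul0r.
      rewrite tw mderivX mnm1E; have [->|] := eqVneq j i; last by rewrite scale0r mulr0.
      by rewrite Hu // comp_mpoly0 mul0r.
    exists w; rewrite comp_mpolyA -Hw; apply: (comp_mpoly_eq_off char0 dH) => i /maxP[j ->].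
    by rewrite tnth_mktuple tw comp_mpolyXi g'w.
  pose u : d.-tuple {mpoly k[d.+1]} := [tuple 'X_(widen_ord (leqnSn d) i) | i < d].
  have <- : H' \mPo u = H; last by rewrite H'0 comp_mpoly0.
  rewrite comp_mpolyA -[RHS]comp_mpoly_id; apply: (comp_mpoly_eq_off char0 dH) => i /maxP[j ->].
  by rewrite tnth_mktuple tw comp_mpolyXi !tnth_mktuple.
pose T := H^`M(ord_max) \mPo g'.
(* The derivative has smaller degree, so it cannot be another relation. *)
have Tv : ~ rdvd v T.
  move=> vT; have := mderiv_msize d0; rewrite ltnNge; apply/negP/negPn.
  apply: Hmin; apply/asboolP; exists H^`M(ord_max); split=> //; split=> // i mi.
  by rewrite mderiv_comm (Hu i mi) mderiv0.
(* Differentiating [H \mPo g' = w * v] leaves [w] times the gradient of [v] modulo [v]. That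
   gradient belongs to the marked component, whose coefficient absorbs [w]. *)
pose c (i : nat) := (if mark == Some i then w else 0) -
  (if insub i is Some j then H^`M(widen_ord (leqnSn d) j) \mPo g' else 0).
exists T, c; split=> // m.
have := congr1 (mderiv m) Hw; rewrite mderiv_comp big_ord_recr /= g'l mderivM => e.
have eT : (l == m)%:R * T = w^`M(m) * v + w * v^`M(m)
   - \sum_(i < d) (H^`M(widen_ord (leqnSn d) i) \mPo g') * (tnth g i)^`M(m).
  rewrite -e; under eq_bigr do rewrite g'w.
  rewrite addrAC subrr add0r mderivX mnm1E mulrC -/T; have [->|] := eqVneq l m; last by rewrite scale0r.
  rewrite scale1r (_ : (U_(m) - U_(m))%MM = 0%MM) ?mpolyX0 //.
  by apply/mnmP=> i; rewrite mnmBE subnn mnm0E.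
rewrite eT -addrA -opprD -big_split /=.
under eq_bigr => i _.
  rewrite -mulrDl /c valK addrC subrK.
  over.
rewrite -addrA; apply: rdvdD; first by apply: rdvd_mull; apply: rdvd_refl.
case: gm => [[mN v00]|[v0 [i mi gi]]].
  rewrite v00 mderiv0 mulr0 sub0r big1 ?oppr0 => [|i _]; first exact: rdvdr0.
  by rewrite mN mul0r.
rewrite (bigD1 i) //= mi eqxx gi big1 ?addr0 ?subrr; first exact: rdvdr0.
move=> j ji; case: eqP => [[/val_inj ej]|]; last by rewrite mul0r.
by rewrite ej eqxx in ji.
Qed.

(** By maximality every variable is dependent, so the relations give [diag T = C *m jacobian g]
    modulo [v], and the prime [v] does not divide the product of the [T l]. If [d < n], the Jacobian
    would have a zero row. *)
Lemma jacobian_not_dvd d (g : d.-tuple S) : (d <= n)%N ->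
  marked_tuple g -> independent_mod g ->
  (forall l, ~ independent_mod [tuple of rcons g 'X_l]) ->
  d = n /\ ~ rdvd v (\det (jacobian g)).
Proof.
move=> dn gm gI gmax.
have /choice[T /choice[c TcP]] l := relation_of_dependent gm gI (gmax l).
pose C : 'M[S]_n := \matrix_(l, i) if (i < d)%N then c l i else 0.
have Tv : ~ rdvd v (\prod_l T l).
  elim/big_rec: _ => // l y _ yv /vM[Tl|//].
  by have [] := TcP l.
have CJ : rdvd v (\det (diag_mx (\row_l T l)) - \det (C *m jacobian g)).
  apply: rdvd_det_sub => l m; have [_ /(_ m)] := TcP l; rewrite !mxE mulr_natl.
  congr (rdvd v (_ - _)); symmetry.
  transitivity (\sum_(i < n | (i < d)%N) c l i * (g`_i)^`M(m)).
    by rewrite [RHS]big_mkcond; apply: eq_bigr => i _; rewrite !mxE; case: ifP; rewrite ?mul0r.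
  by rewrite (big_ord_narrow dn); apply: eq_bigr => i _; rewrite (tnth_nth 0).
have Jv : ~ rdvd v (\det (jacobian g)).
  move=> vJ; apply: Tv; move: CJ; rewrite det_diag det_mulmx => CJ.
  have <- : \prod_i (\row_l T l) 0 i = \prod_l T l by apply: eq_bigr => l _; rewrite mxE.
  by rewrite -[X in rdvd v X](subrK (\det C * \det (jacobian g))); apply/rdvdD/rdvd_mull.
split=> //; apply/eqP; rewrite eqn_leq dn leqNgt; apply/negP=> lt; apply: Jv.
rewrite (expand_det_row _ (Ordinal lt)) big1 => [|m _]; first exact: rdvdr0.
by rewrite mxE nth_default ?size_tuple //= mderiv0 mul0r.
Qed.

(** Variables are appended while independence modulo [v] persists; the size bound and the previous
    lemma make this stop exactly at length [n]. *)
Lemma jacobian_extension e d (g : d.-tuple S) : (d + e)%N = n ->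
  marked_tuple g -> independent_mod g ->
  exists s : seq 'I_n, size s = e /\
    ~ rdvd v (\det (jacobian (g ++ [seq 'X_i | i <- s]))).
Proof.
elim: e d g => [|e IHe] d g den gm gI;
  have [gmax|/existsNP[l /contrapT lI]] :=
    pselect (forall l, ~ independent_mod [tuple of rcons g 'X_l]).
- exists [::]; split=> //; rewrite cats0.
  have dn : (d <= n)%N by apply: leq_trans (eq_leq den); rewrite leq_addr.
  by have [] := jacobian_not_dvd dn gm gI gmax.
- have lm : marked_tuple [tuple of rcons g 'X_l].
    case: gm => [|[v0 [i mi gi]]]; [by left|right]; split=> //.
    exists (widen_ord (leqnSn d) i) => //.
    by rewrite (tnth_nth 0) /= nth_rcons size_tuple ltn_ord -tnth_nth.
  have := independent_mod_size lm lI.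
  by move=> lt; have := leq_trans lt (eq_leq (esym den)); rewrite addn0 ltnn.
- have dn : (d <= n)%N by apply: leq_trans (eq_leq den); rewrite leq_addr.
  have [{}dn _] := jacobian_not_dvd dn gm gI gmax.
  by move/eqP: den; rewrite -{1}dn -[eqbRHS]addn0 eqn_add2l.
- have lm : marked_tuple [tuple of rcons g 'X_l].
    case: gm => [|[v0 [i mi gi]]]; [by left|right]; split=> //.
    exists (widen_ord (leqnSn d) i) => //.
    by rewrite (tnth_nth 0) /= nth_rcons size_tuple ltn_ord -tnth_nth.
  have [|s [ss sP]] := IHe _ _ _ lm lI; first by rewrite addSnnS.
  exists (l :: s); split; first by rewrite /= ss.
  by rewrite /= -cat_rcons.
Qed.

End JacobianCriterion.

(** The image of [v ^+ a.+1 * w] is [v ^+ a] times [a.+1%:R * w * D v + v * D w]; the element [d]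
    inverts [a.+1%:R]. *)
Lemma derivation_multiplicity (R : idomainType) (D : R -> R) (v w d : R) a :
  (forall x y, D (x * y) = D x * y + x * D y) -> prime_elt v -> d * a.+1%:R = 1 ->
  rdvd (v ^+ a.+1) (D (v ^+ a.+1 * w)) -> rdvd v w \/ rdvd v (D v).
Proof.
move=> DM [v0 _ vM] da.
have DX b x : D (x ^+ b.+1) = b.+1%:R * x ^+ b * D x.
  elim: b => [|b IHb]; first by rewrite expr1 expr0 !mul1r.
  by rewrite exprS DM IHb [x ^+ b.+1]exprS -[in RHS]addn1 natrD; ring.
rewrite DM DX exprSr.
rewrite (_ : _ + _ = v ^+ a * (a.+1%:R * (w * D v) + v * D w)); last by ring.
move/(rdvd_mul2l (expf_neq0 a v0)) => vs; apply: vM.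
rewrite -[_ * _]mul1r -da -mulrA; apply: rdvd_mull.
rewrite -[X in rdvd v X](addrK (v * D w)); apply: rdvdB => //.
by apply/rdvd_mulr/rdvd_refl.
Qed.

Section Multiplicity.

Variables (k : fieldType) (n : nat).
Implicit Types (v w : {mpoly k[n]}).

Lemma msize1_unit v : v != 0 -> (msize v <= 1)%N -> rdvd v 1.
Proof.
move=> v0 /msize1_polyC ev; have c0 : v@_0 != 0.
  by apply: contraNneq v0 => c0; rewrite ev c0 mpolyC0.
by exists (v@_0)^-1%:MP; rewrite ev -mpolyCM mcoeffC eqxx mulr1 mulVf.
Qed.

Lemma rdvd_msize v w : w != 0 -> rdvd v w -> (msize v <= msize w)%N.
Proof.
move=> w0 [c ew]; have c0 : c != 0 by apply: contraNneq w0 => c0; rewrite ew c0 mul0r.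
have v0 : v != 0 by apply: contraNneq w0 => v0; rewrite ew v0 mulr0.
by rewrite ew msizeM // (mpolySpred _ c0) addSn leq_addl.
Qed.

Lemma multiplicity_split v w : prime_elt v -> w != 0 ->
  exists a c, w = v ^+ a * c /\ ~ rdvd v c.
Proof.
move=> [v0 v1 _]; have sv : (1 < msize v)%N.
  by rewrite ltnNge; apply/negP=> /(msize1_unit v0).
have [m] := ubnP (msize w); elim: m w => // m IHm w sw w0.
have [[c ew]|vw] := pselect (rdvd v w); last by exists 0, w; rewrite mul1r.
have c0 : c != 0 by apply: contraNneq w0 => c0; rewrite ew c0 mul0r.
have sc : (msize c < m)%N.
  move: sw; rewrite ew msizeM //; case: (msize v) sv => [|[|s]] // _.
  by rewrite !addnS /= ltnS => h; apply: leq_ltn_trans h; rewrite leq_addr.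
have [a [d [ec vd]]] := IHm c sc c0.
by exists a.+1, d; split=> //; rewrite ew ec exprS; ring.
Qed.

End Multiplicity.

(** * Common factors of the Jacobian minors of free generators *)

Section UnramifiedJacobian.

Variables (k : fieldType) (char0 : [pchar k] =i pred0) (n r t : nat).
Hypothesis rt : (r + t)%N = n.
Variables (Y : {mpoly k[n]} -> Prop) (f : r.-tuple {mpoly k[n]}).
Hypothesis f_free : freely_generated Y f.
Hypothesis Ycomp : forall H, Y (H \mPo f).
Hypothesis Ydiv : forall a b, a != 0 -> Y a -> Y (a * b) -> Y b.
Implicit Types (u H : {mpoly k[r]}).

Let f_ind : alg_independent f. Proof. by case: f_free. Qed.

Lemma comp_free_neq0 H : H != 0 -> H \mPo f != 0.
Proof. by apply: contra_neq => /f_ind. Qed.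

(** The quotient lies in [Y], which is closed under exact division, so it is again a polynomial in
    [f]. *)
Lemma comp_free_dvd u H : u != 0 -> rdvd (u \mPo f) (H \mPo f) -> rdvd u H.
Proof.
move=> u0 [c ec]; have [_ _ gen] := f_free.
have [|C eC] := gen c.
  apply: (Ydiv (comp_free_neq0 u0) (Ycomp u)).
  by rewrite mulrC -ec; apply: Ycomp.
exists C; apply/eqP; rewrite -subr_eq0; apply/eqP/f_ind.
by rewrite comp_mpolyB comp_mpolyM -eC ec subrr.
Qed.

(** If every prime factor of [u \mPo f] divided some [H \mPo f] with [u] not dividing [H], the
    product of these [H] would be divisible by [u], against primality. *)
Lemma exists_prime_above u : prime_elt u ->
  exists v, [/\ prime_elt v, rdvd v (u \mPo f) &
    forall H, rdvd v (H \mPo f) -> rdvd u H].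
Proof.
move=> [u0 u1 uM]; apply: contrapT => noV.
have [s [c [sP c1 eU]]] := factorial_mpoly (comp_free_neq0 u0).
have bad v : v \in s -> exists H, rdvd v (H \mPo f) /\ ~ rdvd u H.
  move=> sv; apply: contrapT => noH; apply: noV; exists v; split; first exact: sP.
    by rewrite eU; apply: rdvd_mull; rewrite (perm_big _ (perm_to_rem sv)) big_cons; apply/rdvd_mulr/rdvd_refl.
  by move=> H vH; apply: contrapT => uH; apply: noH; exists H.
have [H [sH uH]] : exists H, rdvd (\prod_(v <- s) v) (H \mPo f) /\ ~ rdvd u H.
  elim: s {sP eU} bad => [|v s IHs] bad.
    by exists 1; rewrite big_nil comp_mpoly1; split=> //; apply: rdvd_refl.
  have [|G [sG uG]] := IHs; first by move=> w sw; apply: bad; rewrite inE sw orbT.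
  have [H [vH uH]] := bad v (mem_head _ _).
  exists (H * G); rewrite big_cons comp_mpolyM; split; first exact: rdvd_mul.
  by move=> /uM[].
apply: uH; apply: comp_free_dvd => //; rewrite eU.
by rewrite -[H \mPo f]mul1r; apply: rdvd_mul.
Qed.

Lemma jacobian_free_coprime q : Y q -> q != 0 ->
  (forall s : seq 'I_n, size s = t ->
     rdvd q (\det (jacobian (f ++ [seq 'X_i | i <- s])))) -> rdvd q 1.
Proof.
move=> Yq q0 qJ; have [_ _ /(_ q Yq)[Q eQ]] := f_free.
have Q0 : Q != 0 by apply: contraNneq q0 => Q0; rewrite eQ Q0 comp_mpoly0.
have [[|u us] [c [usP c1 eQu]]] := factorial_mpoly Q0.
  move: c1; rewrite big_nil mulr1 in eQu; rewrite -eQu => -[d ed].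
  by exists (d \mPo f); rewrite eQ -comp_mpolyM -ed comp_mpoly1.
have uP : prime_elt u by apply: usP; rewrite mem_head.
have uQ : rdvd u Q by rewrite eQu big_cons; apply/rdvd_mull/rdvd_mulr/rdvd_refl.
have [u0 u1 uM] := uP; pose U := u \mPo f.
have Uq : rdvd U q by have [d ed] := uQ; exists (d \mPo f); rewrite eQ ed comp_mpolyM.
have [v [vP vU vu]] := exists_prime_above uP.
have [v0 v1 vM] := vP.
have [a [w [eU vw]]] := multiplicity_split vP (comp_free_neq0 u0).
have a0 : (0 < a)%N by case: a eU => // eU; case: vw; rewrite -[w]mul1r -eU.
have [j dj0] : exists j, u^`M(j) != 0.
  apply: contrapT => /forallNP dj; apply: u1; apply: msize1_unit => //.
  rewrite -mlead_deg // ltnS leqn0 mdeg_eq0; apply/eqP/mnmP=> i; rewrite mnm0E.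
  apply: (mderiv_eq0_msupp char0) (mlead_supp u0).
  by have /negP/negPn/eqP := dj i.
have udj : ~ rdvd u u^`M(j).
  by move/(rdvd_msize dj0); rewrite leqNgt mderiv_msize.
(* Modulo [v] the generators satisfy the relation [u], which involves the variable of index [j];
   that generator gives way to [v]. *)
pose g : r.-tuple {mpoly k[n]} := [tuple if i == j then v else tnth f i | i < r].
have gj : tnth g j = v by rewrite tnth_mktuple eqxx.
have gf l : l != j -> tnth g l = tnth f l by move=> lj; rewrite tnth_mktuple (negbTE lj).
clearbody g.
have gm : marked_tuple v (Some (val j)) g by right; split=> //; exists j.
have natr_inv l m : (0 < m)%N -> exists d : {mpoly k[l]}, d * m%:R = 1.
  move=> m0; exists (m%:R^-1)%:MP; rewrite -(rmorph_nat (@mpolyC l k)) -mpolyCM mulVf //.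
  by move/pcharf0P: char0 => ->; rewrite -lt0n.
(* If [v] divides [H \mPo f], then [u] divides [H]. When [H] is free of ['X_j], differentiating its
   factorisation by powers of [u] would make [u] divide its own derivative along [j]. *)
have gI : independent_mod v (Some (val j)) g.
  move=> H /(_ j (erefl _)) dH.
  rewrite (comp_mpoly_eq_off (h := f) char0 dH) => [vH|//].
  apply/eqP; case: eqVneq => // H0.
  have [b [d [eH ud]]] := multiplicity_split uP H0.
  case: b eH => [|b] eH; first by case: ud; rewrite -[d]mul1r -eH; apply: vu.
  have [e ee] := natr_inv r b.+1 isT.
  have := derivation_multiplicity (@mderivM r k j) uP ee (w := d).
  by rewrite -eH dH => /(_ (rdvdr0 _))[].
have [s [st vJ]] := jacobian_extension char0 vM v1 rt gm gI.
have /(rdvd_trans Uq) UJ := qJ s st.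
have jn : (j < n)%N by rewrite -rt (leq_trans (ltn_ord j)) ?leq_addr.
pose j' := Ordinal jn.
set Jf := jacobian (f ++ _) in UJ; set Jg := jacobian (g ++ _) in vJ.
(* The determinant of [Jf] with row [j] replaced by the gradient of [h]: a derivation killing every
   generator except that of index [j]. *)
pose L (h : {mpoly k[n]}) := \sum_m h^`M(m) * cofactor Jf j' m.
have LM x y : L (x * y) = L x * y + x * L y.
  rewrite /L mulr_suml mulr_sumr -big_split /=; apply: eq_bigr => m _.
  by rewrite mderivM; ring.
have Lf i : L (tnth f i) = (i == j)%:R * \det Jf.
  have id : (i < n)%N by rewrite -rt (leq_trans (ltn_ord i)) ?leq_addr.
  have := congr1 (fun M : 'M_n => M (Ordinal id) j') (mul_mx_adj Jf).
  rewrite !mxE => e; rewrite mulr_natl; etransitivity; last exact: e.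
  apply: eq_bigr => m _.
  by rewrite !mxE nth_cat size_tuple /= ltn_ord -tnth_nth.
have LU : L (u \mPo f) = (u^`M(j) \mPo f) * \det Jf.
  rewrite /L; under eq_bigr do rewrite mderiv_comp mulr_suml.
  rewrite exchange_big /= (bigD1 j) //= [X in _ + X]big1 ?addr0.
    have := Lf j; rewrite eqxx mul1r => <-; rewrite /L mulr_sumr.
    by apply: eq_bigr => m _; rewrite -mulrA.
  move=> i ij; have := Lf i; rewrite (negbTE ij) mul0r => Li.
  transitivity ((u^`M(i) \mPo f) * L (tnth f i)); last by rewrite Li mulr0.
  by rewrite /L mulr_sumr; apply: eq_bigr => m _; rewrite -mulrA.
have Lv : L v = \det Jg.
  rewrite /L (expand_det_row Jg j').
  apply: eq_bigr => m _.
  have -> : Jg j' m = v^`M(m) by rewrite mxE nth_cat size_tuple /= ltn_ord -tnth_nth gj.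
  suff -> : cofactor Jf j' m = cofactor Jg j' m by [].
  rewrite /cofactor; congr (_ * \det _); apply/matrixP=> i l; rewrite !mxE !nth_cat !size_tuple.
  case: ltnP => // ir; have -> : lift j' i = Ordinal ir :> nat by [].
  rewrite -!tnth_nth gf //; apply: contraTneq (neq_lift j' i) => ij.
  by rewrite negbK; apply/eqP/val_inj; exact: esym (congr1 val ij).
case: a a0 eU => // a _ eU.
have vaL : rdvd (v ^+ a.+1) (L (u \mPo f)).
  rewrite LU; apply/rdvd_mull/(rdvd_trans _ UJ); rewrite /U eU.
  by apply/rdvd_mulr/rdvd_refl.
have [d ed] := natr_inv n a.+1 isT.
rewrite eU in vaL; have [//|] := derivation_multiplicity LM vP ed vaL.
by rewrite Lv.
Qed.

End UnramifiedJacobian.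

(** * The Poisson algebra of a Lie algebra *)

Section Coordinates.

Variables (k : fieldType) (L : vectType k) (n : nat) (x : n.-tuple L).
Hypothesis x_basis : basis_of {:L} x.

Definition coord_row (v : L) : 'rV[k]_n := \row_i coord x i v.

Lemma coord_row_sum m (c : 'I_m -> k) (w : 'I_m -> L) :
  coord_row (\sum_i c i *: w i) = \sum_i c i *: coord_row (w i).
Proof.
apply/rowP=> j; rewrite mxE summxE linear_sum; apply: eq_bigr => i _ /=.
by rewrite !mxE linearZ.
Qed.

Lemma coord_row_inj : injective coord_row.
Proof.
move=> v w /rowP e; rewrite (coord_basis x_basis (memvf v)) (coord_basis x_basis (memvf w)).
by apply: eq_bigr => i _; have := e i; rewrite !mxE => ->.
Qed.

Lemma coord_row_vec (u : 'rV[k]_n) : coord_row (\sum_i u 0 i *: tnth x i) = u.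
Proof.
apply/rowP=> j; rewrite mxE linear_sum (bigD1 j) //= big1 => [|i ij].
  by rewrite linearZ (tnth_nth 0) /= (coord_free _ _ (basis_free x_basis)) eqxx addr0 /= mulr1.
by rewrite linearZ (tnth_nth 0) /= (coord_free _ _ (basis_free x_basis)) (negbTE ij) /= mulr0.
Qed.

Lemma dim_left_kernel (U : {vspace L}) (N : 'M[k]_n) :
  (forall v, (v \in U) = (coord_row v *m N == 0)) -> (\dim U + \rank N)%N = n.
Proof.
move=> UP; pose K : 'M_(\dim U, n) := \matrix_i coord_row (tnth (vbasis U) i).
have KE u : u *m K = coord_row (\sum_i u 0 i *: tnth (vbasis U) i).
  by rewrite coord_row_sum mulmx_sum_row; apply: eq_bigr => i _; rewrite rowK.
have KN : (K == kermx N)%MS.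
  apply/andP; split.
    apply/row_subP=> i; rewrite rowK; apply/sub_kermxP/eqP.
    by rewrite -UP (tnth_nth 0); apply: vbasis_mem; rewrite mem_nth // size_tuple.
  apply/rV_subP=> u /sub_kermxP uN.
  have vU : \sum_i u 0 i *: tnth x i \in U by rewrite UP coord_row_vec uN.
  apply/submxP; exists (\row_i coord (vbasis U) i (\sum_i u 0 i *: tnth x i)).
  rewrite KE -{1}[u]coord_row_vec; congr coord_row.
  rewrite {1}(coord_vbasis vU); apply: eq_bigr => i _.
  by rewrite mxE (tnth_nth 0).
have Kfree : row_free K.
  apply/row_freeP; apply: contrapT => nK.
  have : ~~ row_free K by apply/negP=> /row_freeP.
  rewrite -kermx_eq0 => /rowV0Pn[u /sub_kermxP uK u0].
  case/eqP: u0; apply/rowP=> i; rewrite [RHS]mxE.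
  have : \sum_i u 0 i *: (vbasis U)`_i = 0.
    apply: coord_row_inj; rewrite -[coord_row 0]/(coord_row 0).
    transitivity (u *m K).
      by rewrite KE; congr coord_row; apply: eq_bigr => j _; rewrite (tnth_nth 0).
    by rewrite uK; apply/rowP=> j; rewrite !mxE linear0.
  have /freeP := basis_free (vbasisP U).
  by move=> /(_ (fun i => u 0 i)) h /h.
move: Kfree; rewrite /row_free (eqmxP KN) mxrank_ker => /eqP <-.
by rewrite subnK // rank_leq_row.
Qed.

End Coordinates.

Section Selection.

Variables (R : comNzRingType) (n : nat).

(** Rows are unit vectors: for injective [h], the two forms become a principal Pfaffian sum of [B]
    and, up to sign, a maximal minor of [J]. *)
Definition select_mx t (h : 'I_t -> 'I_n) : 'M[R]_(t, n) := rowsub h 1%:M.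

Lemma pf_form_select t (B : 'M[R]_n) (h : 'I_t -> 'I_n) :
  pf_form B (select_mx h) = pfaffian_sum (mxsub h h B).
Proof.
rewrite /pf_form; congr pfaffian_sum; rewrite /select_mx mul_rowsub_mx mul1mx.
rewrite -[rowsub h B *m _]trmxK trmx_mul trmxK mul_rowsub_mx mul1mx.
by apply/matrixP=> i j; rewrite !mxE.
Qed.

Lemma pf_form_select_comp t (t_even : ~~ odd t) (B : 'M[R]_n) (h : 'I_t -> 'I_n) (g : 'I_t -> 'I_t) :
  pf_form B (select_mx (h \o g)) = \det (rowsub g 1%:M : 'M[R]_t) * pf_form B (select_mx h).
Proof.
rewrite /pf_form -pfaffian_sum_congr //; congr pfaffian_sum.
have -> : select_mx (h \o g) = rowsub g 1%:M *m select_mx h.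
  by rewrite mul_rowsub_mx mul1mx; apply/matrixP=> i j; rewrite !mxE.
by rewrite trmx_mul !mulmxA.
Qed.

Lemma pf_form_select_noninj t (t_even : ~~ odd t) (B : 'M[R]_n) (h : 'I_t -> 'I_n) :
  ~ injective h -> pf_form B (select_mx h) = 0.
Proof.
move=> /injectiveP/injectivePn[a [b ab hab]].
pose g i := if i == b then a else i.
have -> : select_mx h = select_mx (h \o g).
  apply/matrixP=> i j; rewrite !mxE /= /g; case: (eqVneq i b) => [->|//]; by rewrite hab.
rewrite pf_form_select_comp // (determinant_alternate ab) ?mul0r // => j.
by rewrite !mxE /g eqxx (negbTE ab).
Qed.

End Selection.

(** The gcd defining [p] runs over increasing selections only; sorting reduces any injective
    selection to one of these. *)
Lemma sorted_factor t n (h : 'I_t -> 'I_n) : injective h ->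
  exists (h' : 'I_t -> 'I_n) (g : 'I_t -> 'I_t),
    {homo h' : i j / (i < j)%N} /\ h = h' \o g.
Proof.
move=> h_inj; pose s := sort (relpre val leq) (codom h).
have ss : size s = t by rewrite size_sort size_codom card_ord.
have us : uniq s by rewrite sort_uniq /codom map_inj_uniq ?enum_uniq.
have hs i : (index (h i) s < t)%N by rewrite -[X in (_ < X)%N]ss index_mem mem_sort codom_f.
exists (fun i => nth (h i) s i), (fun i => Ordinal (hs i)); split; last first.
  by apply/funext=> i; rewrite /= nth_index // mem_sort codom_f.
have srt : sorted ltn (map val s).
  rewrite ltn_sorted_uniq_leq map_inj_uniq ?us /=; last exact: val_inj.
  by rewrite sorted_map; apply: sort_sorted => a b; apply: leq_total.
move=> i j ij.
have := sorted_ltn_nth ltn_trans 0 srt; rewrite size_map ss => /(_ i j).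
rewrite !inE !ltn_ord => /(_ isT isT ij).
by rewrite (nth_map (h i)) ?ss // (nth_map (h j)) ?ss.
Qed.

Section SkewPrincipal.

Variables (k : fieldType) (char0 : [pchar k] =i pred0).

(** For a skew matrix, rows that span the row space select columns that span the column space, so
    the principal submatrix on a maximal independent set of rows is invertible. *)
Lemma skew_principal_pfaffian n (B : 'M[k]_n) : B^T = - B ->
  ~~ odd (\rank B) /\ exists h : 'I_(\rank B) -> 'I_n, pf_form B (select_mx k h) != 0.
Proof.
move=> BT; pose h : 'I_(\rank B) -> 'I_n := maxrankfun B; pose R := select_mx k h.
have RB : R *m B = rowsub h B by rewrite mul_rowsub_mx mul1mx.
have [X eX] : exists X, B = X *m (R *m B).
  by apply/submxP; rewrite RB; have /eqmxP/andP[_ ] := eq_maxrowsub B.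
have RBT : (R *m B *m R^T)^T = - (R *m B *m R^T) by apply: skew_congr.
have eRB : R *m B = (R *m B *m R^T) *m X^T.
  have := congr1 trmx eX; rewrite !trmx_mul BT => eBT.
  rewrite -!mulmxA; congr (R *m _); apply: oppr_inj.
  by rewrite {1}eBT !mulNmx mulmxA.
have Ru : R *m B *m R^T \in unitmx.
  rewrite -row_free_unit /row_free eqn_leq rank_leq_row /=.
  apply: leq_trans (mxrankM_maxl _ X^T).
  by rewrite -eRB RB eq_maxrowsub.
split; first exact: skew_unit_even Ru.
by exists h; apply: pfaffian_sum_unit.
Qed.

End SkewPrincipal.

(** * The Poisson structure in coordinates *)

Section LiePoisson.

Variables (k : fieldType) (L : lieAlgType k) (n : nat) (x : n.-tuple L).
Hypothesis x_basis : basis_of {:L} x.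
Local Notation S := {mpoly k[n]}.
Implicit Types (u v w : L) (f g : S).

Lemma lieDl u v w : lie (u + v) w = lie u w + lie v w.
Proof. by have := lie_linearl w 1 u v; rewrite !scale1r. Qed.

Lemma lieDr u v w : lie u (v + w) = lie u v + lie u w.
Proof. exact: linearD. Qed.

Lemma lieC u v : lie v u = - lie u v.
Proof.
apply/eqP; rewrite -addr_eq0; apply/eqP.
by have := liexx (u + v); rewrite lieDl !lieDr !liexx add0r addr0 addrC.
Qed.

Lemma lie_sumr (I : finType) u (c : I -> k) (w : I -> L) :
  lie u (\sum_i c i *: w i) = \sum_i c i *: lie u (w i).
Proof. by rewrite linear_sum; apply: eq_bigr => i _; rewrite linearZ. Qed.

Lemma lie_suml (I : finType) u (c : I -> k) (w : I -> L) :
  lie (\sum_i c i *: w i) u = \sum_i c i *: lie (w i) u.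
Proof.
rewrite lieC lie_sumr -sumrN; apply: eq_bigr => i _.
by rewrite [lie (w i) u]lieC scalerN.
Qed.

Lemma lie_derivation u v w : lie u (lie v w) = lie (lie u v) w + lie v (lie u w).
Proof.
have /eqP := lie_jacobi u v w.
rewrite -addrA addr_eq0 => /eqP ->.
by rewrite opprD [lie w (lie u v)]lieC [lie w u]lieC linearN /= !opprK addrC.
Qed.

Lemma coord_sum v : v = \sum_i coord x i v *: tnth x i.
Proof.
rewrite {1}(coord_basis x_basis (memvf v)).
by apply: eq_bigr => i _; rewrite (tnth_nth 0).
Qed.

Lemma sym_inj_is_linear : linear (sym_inj x).
Proof.
move=> a v w; rewrite /sym_inj scaler_sumr -big_split /=; apply: eq_bigr => i _.
by rewrite linearP /= scalerDl scalerA.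
Qed.

HB.instance Definition _ :=
  GRing.isSemilinear.Build k L S _ (sym_inj x) (GRing.semilinear_linear sym_inj_is_linear).

Lemma sym_inj_sum (I : finType) (c : I -> k) (w : I -> L) :
  sym_inj x (\sum_i c i *: w i) = \sum_i c i *: sym_inj x (w i).
Proof. by rewrite linear_sum; apply: eq_bigr => i _; rewrite linearZ. Qed.

Lemma mderiv_sym_inj v i : (sym_inj x v)^`M(i) = (coord x i v)%:MP.
Proof.
rewrite /sym_inj raddf_sum (bigD1 i) //= big1 ?addr0 => [|j ji].
  have UU : (U_(i) - U_(i))%MM = 0%MM by apply/mnmP=> j; rewrite mnmBE subnn mnm0E.
  by rewrite mderivZ mderivX mnm1E eqxx scale1r UU mpolyX0 -mul_mpolyC mulr1.
by rewrite mderivZ mderivX mnm1E (negbTE ji) scale0r scaler0.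
Qed.

Lemma mcoeff_sym_inj v i : (sym_inj x v)@_(U_(i)) = coord x i v.
Proof.
have := mcoeff_mderiv i (sym_inj x v) 0%MM.
by rewrite add0m mnm0E mulr1n mderiv_sym_inj mcoeffC eqxx mulr1.
Qed.

Lemma sym_inj_inj : injective (sym_inj x).
Proof.
move=> v w e; apply: (coord_row_inj x_basis); apply/rowP=> i.
by rewrite !mxE -!mcoeff_sym_inj e.
Qed.

Lemma sym_ad_zmod v : zmod_morphism (sym_ad x v).
Proof.
move=> f g; rewrite /sym_ad -sumrB; apply: eq_bigr => i _.
by rewrite mderivB mulrBr.
Qed.

Lemma sym_adM v f g : sym_ad x v (f * g) = sym_ad x v f * g + f * sym_ad x v g.
Proof.
rewrite /sym_ad mulr_suml mulr_sumr -big_split /=; apply: eq_bigr => i _.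
by rewrite mderivM; ring.
Qed.

Lemma sym_adC v c : sym_ad x v c%:MP = 0.
Proof. by rewrite /sym_ad big1 // => i _; rewrite mderivC mulr0. Qed.

Lemma sym_ad_sym_inj v w : sym_ad x v (sym_inj x w) = sym_inj x (lie v w).
Proof.
rewrite [w in RHS]coord_sum lie_sumr sym_inj_sum; apply: eq_bigr => i _.
by rewrite mderiv_sym_inj mulrC mul_mpolyC.
Qed.

Lemma sym_ad_comp v r (f : r.-tuple S) H :
  sym_ad x v (H \mPo f) = \sum_i (H^`M(i) \mPo f) * sym_ad x v (tnth f i).
Proof.
rewrite /sym_ad; under eq_bigr do rewrite mderiv_comp mulr_sumr.
rewrite exchange_big; apply: eq_bigr => i _ /=; rewrite mulr_sumr.
by apply: eq_bigr => j _; ring.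
Qed.

Lemma Ysym_comp r (f : r.-tuple S) : (forall i, Ysym x (tnth f i)) ->
  forall H, Ysym x (H \mPo f).
Proof.
by move=> fY H v; rewrite sym_ad_comp big1 // => i _; rewrite fY mulr0.
Qed.

Lemma Ysym_div f g : f != 0 -> Ysym x f -> Ysym x (f * g) -> Ysym x g.
Proof.
move=> f0 Yf Yfg v; have /eqP := Yfg v.
by rewrite sym_adM Yf mul0r add0r mulf_eq0 (negbTE f0) => /eqP.
Qed.

Local Notation B := (structure_mx x).

Lemma structure_mx_skew : B^T = - B.
Proof. by apply/matrixP=> i j; rewrite !mxE lieC linearN. Qed.

(** Row [i] holds the coordinates of the bracket of [v] with the [i]-th basis vector: the transpose
    of the matrix in [unimodular], with the same trace. *)
Definition ad_mx v : 'M[S]_n := \matrix_(i, j) (coord x j (lie v (tnth x i)))%:MP.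

Lemma sym_inj_lie v i : sym_inj x (lie v (tnth x i)) = \sum_j ad_mx v i j * 'X_j.
Proof. by apply: eq_bigr => j _; rewrite mxE mul_mpolyC. Qed.

Lemma map_sym_ad_structure v :
  map_mx (sym_ad x v) B = ad_mx v *m B + B *m (ad_mx v)^T.
Proof.
apply/matrixP=> i j; rewrite mxE [B i j]mxE sym_ad_sym_inj lie_derivation.
rewrite linearD /= [RHS]mxE.
congr (_ + _).
  rewrite [lie v (tnth x i)]coord_sum lie_suml sym_inj_sum [RHS]mxE; apply: eq_bigr => l _.
  by rewrite !mxE mul_mpolyC.
rewrite [lie v (tnth x j)]coord_sum lie_sumr sym_inj_sum [RHS]mxE; apply: eq_bigr => l _.
by rewrite !mxE mulrC mul_mpolyC.
Qed.

Definition jacobian_mx r (f : r.-tuple S) : 'M[S]_(r, n) :=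
  \matrix_(i, m) (tnth f i)^`M(m).

Lemma jacobian_mx_structure r (f : r.-tuple S) : (forall i, Ysym x (tnth f i)) ->
  jacobian_mx f *m B = 0.
Proof.
move=> fY; apply/matrixP=> i j; rewrite !mxE.
transitivity (- sym_ad x (tnth x j) (tnth f i)); last by rewrite fY oppr0.
rewrite /sym_ad -sumrN; apply: eq_bigr => m _.
by rewrite !mxE lieC linearN /= mulrN mulrC.
Qed.

(** Differentiate the equation [sym_ad x v (tnth f i) = 0] with respect to each variable. *)
Lemma map_sym_ad_jacobian r (f : r.-tuple S) v : (forall i, Ysym x (tnth f i)) ->
  map_mx (sym_ad x v) (jacobian_mx f) = - (jacobian_mx f *m ad_mx v).
Proof.
move=> fY; apply/matrixP=> i l; rewrite !mxE; apply/eqP; rewrite -addr_eq0; apply/eqP.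
transitivity ((sym_ad x v (tnth f i))^`M(l)); last by rewrite fY mderiv0.
rewrite /sym_ad [RHS]raddf_sum -big_split /=; apply: eq_bigr => m _.
by rewrite mderivM mderiv_sym_inj !mxE mderiv_comm; ring.
Qed.

Lemma map_sym_ad_select v t (h : 'I_t -> 'I_n) :
  map_mx (sym_ad x v) (select_mx S h) = 0.
Proof.
apply/matrixP=> i j; rewrite !mxE -[_%:R](rmorph_nat (@mpolyC n k)).
exact: sym_adC.
Qed.

Lemma mxtrace_ad_mx v : unimodular x -> \tr (ad_mx v) = 0.
Proof.
move=> /(_ v) tr0; rewrite -[RHS](mpolyC0 n) -tr0 rmorph_sum.
by apply: eq_bigr => i _; rewrite !mxE lfunE.
Qed.

Section Index.

Hypothesis char0 : [pchar k] =i pred0.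

Lemma dimL : \dim {:L} = n.
Proof. exact: vector.size_basis x_basis. Qed.

Lemma lie_index_le : (lie_index L <= n)%N.
Proof.
rewrite /lie_index; case: ex_minnP => d /asboolP[xi <-] _.
by rewrite -dimL; apply/dimvS/subvf.
Qed.

(* Evaluating the structure matrix at a functional xi realizing the index. *)
Lemma exists_principal_pfaffian : ~~ odd (n - lie_index L) /\
  exists h : 'I_(n - lie_index L) -> 'I_n, pf_form B (select_mx S h) != 0.
Proof.
have [xi exi] : exists xi : 'Hom(L, k^o), \dim (lie_stab xi) = lie_index L.
  by rewrite /lie_index; case: ex_minnP => d /asboolP[xi exi] _; exists xi.
pose ev := meval (fun i => xi (tnth x i) : k).
pose Bxi : 'M[k]_n := map_mx ev B.
have evB v : ev (sym_inj x v) = xi v.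
  rewrite [v in RHS]coord_sum linear_sum /sym_inj /ev (raddf_sum (meval _)); apply: eq_bigr => i _ /=.
  by rewrite mevalZ mevalXU linearZ.
have BxiT : Bxi^T = - Bxi by rewrite map_trmx structure_mx_skew map_mxN.
have dimB : (\dim (lie_stab xi) + \rank Bxi)%N = n.
  apply: (dim_left_kernel x_basis) => v.
  have vB j : (coord_row x v *m Bxi) 0 j = xi (lie v (tnth x j)).
    rewrite [v in RHS]coord_sum lie_suml linear_sum !mxE; apply: eq_bigr => i _ /=.
    by rewrite !mxE evB linearZ.
  apply/lie_stabP/eqP => [vxi|vB0 y].
    by apply/rowP=> j; rewrite vB vxi mxE.
  rewrite [y]coord_sum lie_sumr linear_sum big1 // => j _ /=.
  by rewrite linearZ /= -vB vB0 mxE scaler0.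
have {dimB} eB : (n - lie_index L)%N = \rank Bxi by rewrite -exi -{1}dimB addKn.
have [B_even [h hB]] := skew_principal_pfaffian char0 BxiT.
rewrite eB; split=> //; exists h; apply: contraNneq hB => h0.
have -> : select_mx k h = map_mx ev (select_mx S h) by rewrite /select_mx map_mxsub map_mx1.
by rewrite map_pf_form h0 rmorph0.
Qed.

Lemma pfaffianE t (A : 'M[S]_t) : ~~ odd t ->
  exists2 c : k, c != 0 & pfaffian A = c *: pfaffian_sum A.
Proof.
move=> t_even; exists (2 ^ t./2 * (t./2)`!)%:R^-1; last by rewrite /pfaffian (negbTE t_even).
by rewrite invr_neq0 // (char0_natf_eq0 char0) -lt0n muln_gt0 expn_gt0 fact_gt0.
Qed.

(** In the abelian case the index is [n], and the only Pfaffian is that of the empty matrix, a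
    nonzero constant; so both cases of the definition take the same form. *)
Lemma fundamental_gcd p : fundamental_semi_invariant x p ->
  is_gcd (principal_pfaffian x (n - lie_index L)) p.
Proof.
move=> [pab pnab]; have [ab|] := pselect (abelian_lie L); last first.
  by have <- : (\dim {:L} - lie_index L = n - lie_index L)%N; [rewrite dimL|apply: pnab].
rewrite pab // (_ : (n - _)%N = 0%N); last first.
  apply/eqP; rewrite subn_eq0 /lie_index; case: ex_minnP => d /asboolP[xi <-] _.
  rewrite -dimL; apply/dimvS/subvP=> v _; apply/lie_stabP=> y.
  by rewrite ab linear0.
split=> [q _|c cP]; first by exists q; rewrite mulr1.
pose h (i : 'I_0) : 'I_n := match i with Ordinal _ hi => False_rect _ (notF hi) end.
have [|a ea] := cP (pfaffian (mxsub h h B)); first by exists h => // -[].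
have [b b0 eb] := pfaffianE (mxsub h h B) isT.
have e1 : pfaffian_sum (mxsub h h B) = 1.
  rewrite -(det_mx00 (mxsub h h B)); apply: eq_bigr => s _.
  by rewrite !big_ord0.
exists (b^-1 *: a); rewrite -scalerAl -ea eb e1 scalerA mulVf //.
by rewrite scale1r.
Qed.

End Index.
End LiePoisson.

(** * Degrees of the generators *)

Section Degrees.

Variables (k : fieldType) (n : nat).
Implicit Types (p q : {mpoly k[n]}).

Lemma tdegM p q : p != 0 -> q != 0 -> tdeg (p * q) = (tdeg p + tdeg q)%N.
Proof.
move=> p0 q0; rewrite /tdeg msizeM //.
by rewrite (mpolySpred _ p0) (mpolySpred _ q0) addSn addnS.
Qed.

Lemma tdeg_dhomog p d : p != 0 -> p \is d.-homog -> tdeg p = d.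
Proof. by move=> p0 pd; apply: dhomog_uniq p0 (dhomog_msize pd) pd. Qed.

Lemma tdeg_unit p : rdvd p 1 -> tdeg p = 0%N.
Proof.
move=> p1; have := rdvd_msize (oner_neq0 _) p1; rewrite msize1 /tdeg.
by case: (msize p) => [|[]].
Qed.

Lemma dhomog_mderiv p d i : p \is d.-homog -> p^`M(i) \is (d.-1).-homog.
Proof.
move=> /dhomogP pd; apply/dhomogP => m; rewrite mcoeff_msupp mcoeff_mderiv => c0.
have : mdeg (m + U_(i))%MM = d.
  by apply: pd; rewrite mcoeff_msupp; apply: contraNneq c0 => ->; rewrite mul0rn.
by rewrite mdegD mdeg1 addn1 => <-.
Qed.

Lemma dhomog_prod_sum (I : Type) (s : seq I) (P : pred I) (F : I -> {mpoly k[n]}) (d : I -> nat) :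
  (forall i, P i -> F i \is (d i).-homog) ->
  \prod_(i <- s | P i) F i \is (\sum_(i <- s | P i) d i)%N.-homog.
Proof.
move=> Fd; apply: (big_rec2 (fun (x : {mpoly k[n]}) y => x \is y.-homog)) => [|i x y Pi xy].
  exact: dhomog1.
by apply: dhomogM => //; apply: Fd.
Qed.

Lemma dhomog_sign (b : bool) p d : p \is d.-homog -> (-1) ^+ b * p \is d.-homog.
Proof. by case: b; rewrite ?mul1r // mulN1r dhomogN. Qed.

Lemma dhomog_det m (A : 'M[{mpoly k[n]}]_m) (d : 'I_m -> nat) :
  (forall i j, A i j \is (d i).-homog) -> \det A \is (\sum_i d i)%N.-homog.
Proof. by move=> Ad; apply: rpred_sum => s _; apply/dhomog_sign/dhomog_prod_sum. Qed.

Lemma dhomog_pfaffian_sum m (A : 'M[{mpoly k[n]}]_m) :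
  (forall i j, A i j \is 1.-homog) -> pfaffian_sum A \is (m./2).-homog.
Proof.
move=> Ad; have -> : m./2 = (\sum_(i < m./2) 1)%N by rewrite sum_nat_const card_ord muln1.
by apply: rpred_sum => s _; apply/dhomog_sign/dhomog_prod_sum.
Qed.

End Degrees.

Section FreeGenerators.

Variables (k : fieldType) (char0 : [pchar k] =i pred0).
Variables (L : lieAlgType k) (n : nat) (x : n.-tuple L) (x_basis : basis_of {:L} x).
Variables (r : nat) (f : r.-tuple {mpoly k[n]}).
Hypotheses (f_homog : forall i, tnth f i \is homog mdeg)
  (f_free : freely_generated (Ysym x) f).

Let fY i : Ysym x (tnth f i). Proof. by case: f_free. Qed.
Let f_ind : alg_independent f. Proof. by case: f_free. Qed.

Lemma dhomog_generator i : tnth f i \is (tdeg (tnth f i)).-homog.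
Proof. by rewrite -homog_msize. Qed.

Lemma tdeg_generator_gt0 i : (0 < tdeg (tnth f i))%N.
Proof.
rewrite lt0n; apply/eqP => d0.
have ef : tnth f i = ((tnth f i)@_0)%:MP.
  by apply: msize1_polyC; move: d0; rewrite /tdeg; case: (msize (tnth f i)) => [|[]].
have := f_ind (g := 'X_i - ((tnth f i)@_0)%:MP).
rewrite comp_mpolyB comp_mpolyXi comp_mpolyC {1}ef subrr => /(_ erefl).
move/(congr1 (mderiv i)); rewrite mderivB mderivC subr0 mderiv0 mderivX mnm1E eqxx scale1r.
have UU : (U_(i) - U_(i))%MM = 0%MM by apply/mnmP=> j; rewrite mnmBE subnn mnm0E.
by rewrite UU mpolyX0 => /eqP; rewrite oner_eq0.
Qed.

Lemma dhomog_sym_inj v : sym_inj x v \is 1.-homog.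
Proof.
apply: rpred_sum => i _; apply: dhomogZ.
by rewrite dhomogX; apply/eqP/mdeg1.
Qed.

(** The linear part of a generator, as a vector of [L]; by homogeneity it is the whole generator or
    zero. *)
Let lin i : L := \sum_l (tnth f i)@_(U_(l)) *: tnth x l.

Let coord_lin i l : coord x l (lin i) = (tnth f i)@_(U_(l)).
Proof.
have /rowP/(_ l) := coord_row_vec x_basis (\row_j (tnth f i)@_(U_(j))).
rewrite !mxE => <-; congr (coord x l _).
by apply: eq_bigr => j _; rewrite mxE.
Qed.

Let sym_inj_lin i : tdeg (tnth f i) = 1%N -> sym_inj x (lin i) = tnth f i.
Proof.
move=> d1; have fh := dhomog_generator i; rewrite d1 in fh.
apply/mpolyP=> m; have [/mdeg1P[l /eqP ->]|m1] := boolP (mdeg m == 1%N).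
  by rewrite mcoeff_sym_inj coord_lin.
by rewrite (dhomog_nemf_coeff fh) // (dhomog_nemf_coeff (dhomog_sym_inj _)).
Qed.

Let lin0 i : tdeg (tnth f i) != 1%N -> lin i = 0.
Proof.
move=> d1; rewrite /lin big1 // => l _.
rewrite (dhomog_nemf_coeff (dhomog_generator i)) ?scale0r //.
by rewrite -[X in X != _]/(mdeg U_(l)) mdeg1 eq_sym.
Qed.

(* The linear invariants are the elements of the center; comparing linear
   parts, they are combinations of the generators of degree 1. *)
Lemma dim_lie_center :
  \dim (lie_center L) = #|[pred i | tdeg (tnth f i) == 1%N]|.
Proof.
set A := [pred i | _]; pose X : #|A|.-tuple L := [tuple lin (enum_val a) | a < #|A|].
have XE (a : 'I_#|A|) : X`_a = lin (enum_val a) by rewrite -tnth_nth tnth_mktuple.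
have dA (a : 'I_#|A|) : tdeg (tnth f (enum_val a)) = 1%N.
  by apply/eqP; have := enum_valP a; rewrite inE.
have X_free : free X.
  apply/freeP=> c c0 a.
  have : sym_inj x (\sum_(i < #|A|) c i *: X`_i) = 0 by rewrite c0 linear0.
  rewrite sym_inj_sum.
  have -> : \sum_i c i *: sym_inj x X`_i = (\sum_i c i *: 'X_(enum_val i)) \mPo f.
    rewrite (raddf_sum (comp_mpoly f)); apply: eq_bigr => b _.
    by rewrite XE sym_inj_lin //= comp_mpolyZ comp_mpolyXi.
  move/f_ind => /(congr1 (mcoeff U_(enum_val a))); rewrite mcoeff0 raddf_sum (bigD1 a) //=.
  rewrite mcoeffZ mcoeffX eqxx mulr1 big1 ?addr0 // => b ba.
  rewrite mcoeffZ mcoeffX; case: eqP => [/mnmP/(_ (enum_val a))|]; last by rewrite mulr0.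
  by rewrite !mnm1E eqxx (inj_eq enum_val_inj) (negbTE ba).
have X_span : <<X>>%VS = lie_center L.
  apply/eqP; rewrite eqEsubv; apply/andP; split.
    apply/span_subvP=> _ /tnthP[a ->]; rewrite tnth_mktuple.
    apply/lie_centerP=> y; apply: (sym_inj_inj x_basis); rewrite linear0.
    by rewrite lieC linearN /= -(sym_ad_sym_inj x_basis) sym_inj_lin // fY oppr0.
  apply/subvP=> z /lie_centerP zZ.
  have zY : Ysym x (sym_inj x z).
    by move=> v; rewrite (sym_ad_sym_inj x_basis) lieC zZ oppr0 linear0.
  have [_ _ /(_ _ zY)[G eG]] := f_free.
  have lin_coef p l : p^`M(l)@_0 = p@_(U_(l)) :> k.
    by rewrite mcoeff_mderiv add0m mnm0E mulr1n.
  (* Chain rule at the origin: the constant terms of the derivatives of [G] along [f] are the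
     coefficients. *)
  have -> : z = \sum_i (G^`M(i) \mPo f)@_0 *: lin i.
    apply: (coord_row_inj x_basis); rewrite coord_row_sum; apply/rowP=> l.
    rewrite mxE -mcoeff_sym_inj eG -lin_coef mderiv_comp raddf_sum summxE.
    apply: eq_bigr => i _; rewrite !mxE coord_lin /= -lin_coef.
    by rewrite rmorphM.
  apply: memv_suml => i _; have [d1|/lin0->] := eqVneq (tdeg (tnth f i)) 1%N; last first.
    by rewrite scaler0 mem0v.
  have iA : i \in A by rewrite inE d1.
  apply/memvZ/memv_span; apply/tnthP; exists (enum_rank_in iA i).
  by rewrite tnth_mktuple enum_rankK_in.
by rewrite -X_span; move: X_free; rewrite /free => /eqP ->; rewrite size_tuple.
Qed.

End FreeGenerators.

Lemma ratio_transfer (R : idomainType) (p q a b a' b' : R) :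
  a != 0 -> a * b' = a' * b -> p * b = q * a -> p * b' = q * a'.
Proof.
move=> a0 ab pq; apply: (mulfI a0).
by rewrite mulrCA ab mulrCA pq; ring.
Qed.

Lemma rdvd_ratio (R : idomainType) (p q a b : R) :
  p != 0 -> p * b = q * a -> rdvd p a -> rdvd q b.
Proof.
move=> p0 pq [c ea]; exists c; apply: (mulfI p0).
by rewrite pq ea; ring.
Qed.

(** * The sum of the degrees of the generators *)

Section SumOfDegrees.

Variables (k : fieldType) (char0 : [pchar k] =i pred0).
Variables (L : lieAlgType k) (r t : nat) (x : (r + t).-tuple L).
Hypothesis x_basis : basis_of {:L} x.
Local Notation n := (r + t)%N.
Local Notation S := {mpoly k[n]}.
Variables (p : S) (f : r.-tuple S).
Hypotheses (p_fund : fundamental_semi_invariant x p) (x_unimod : unimodular x)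
  (pY : Ysym x p) (r_index : r = lie_index L)
  (f_homog : forall i, tnth f i \is homog mdeg)
  (f_free : freely_generated (Ysym x) f).

Local Notation B := (structure_mx x).
Local Notation J := (jacobian_mx f).
Let P (h : 'I_t -> 'I_n) : S := pf_form B (select_mx S h).
Let Q (h : 'I_t -> 'I_n) : S := jac_form J (select_mx S h).

Let fY i : Ysym x (tnth f i). Proof. by case: f_free. Qed.

Let index_eq : (n - lie_index L)%N = t. Proof. by rewrite -r_index addKn. Qed.

Let t_even : ~~ odd t.
Proof. by have [] := exists_principal_pfaffian x_basis char0; rewrite index_eq. Qed.

Let P_neq0 : exists h, P h != 0.
Proof. by have [_] := exists_principal_pfaffian x_basis char0; rewrite index_eq. Qed.

Let PQ h h' : P h * Q h' = P h' * Q h.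
Proof.
by apply: kernel_form_proportional; [|exact: structure_mx_skew|exact: jacobian_mx_structure].
Qed.

Let jacobian_select (s : t.-tuple 'I_n) :
  \det (jacobian (f ++ [seq 'X_i | i <- s])) = Q (tnth s).
Proof.
congr (\det _); apply/matrixP=> i j; rewrite mxE nth_cat size_tuple -[i]splitK.
case: (split i) => i' /=; rewrite ?col_mxEu ?col_mxEd !mxE.
  by rewrite ltn_ord -tnth_nth.
rewrite ltnNge leq_addr /= addKn (nth_map (tnth s i')) ?size_tuple // -tnth_nth.
rewrite mderivX mnm1E; case: eqP => [<-|_]; last by rewrite scale0r.
have UU : (U_(tnth s i') - U_(tnth s i'))%MM = 0%MM.
  by apply/mnmP=> l; rewrite mnmBE subnn mnm0E.
by rewrite UU mpolyX0 scale1r.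
Qed.

(** The Jacobian criterion for [v = 0] without a mark, where divisibility by [v] means vanishing. *)
Let Q_neq0 : exists s : t.-tuple 'I_n, Q (tnth s) != 0.
Proof.
have dvd0 a : rdvd 0 a -> a = 0 :> S by move=> [c ->]; rewrite mulr0.
have vM (a b : S) : rdvd 0 (a * b) -> rdvd 0 a \/ rdvd 0 b.
  move=> /dvd0/eqP; rewrite mulf_eq0 => /orP[]/eqP->; [left|right]; exact: rdvdr0.
have v1 : ~ rdvd 0 (1 : S) by move/dvd0/eqP; rewrite oner_eq0.
have gI : independent_mod 0 None f.
  by move=> H _ /dvd0; case: f_free => _ + _; apply.
have gm : marked_tuple 0 None f by left.
have [s [st sJ]] := jacobian_extension char0 vM v1 (erefl (r + t)%N) gm gI.
have st' : size s == t by rewrite st.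
exists (Tuple st'); rewrite -jacobian_select; apply: contra_not_neq sJ => /= ->.
exact: rdvdr0.
Qed.

(** The ratio is first found on increasing selections, where [p] is a gcd, then carried to all
    selections by proportionality with one nonzero value. *)
Let p_gcd : (forall h, rdvd p (P h)) /\
  exists q : S, forall h, p * Q h = q * P h.
Proof.
have [pP pmax] := fundamental_gcd x_basis char0 p_fund; rewrite index_eq in pP pmax.
pose I := {h : 'I_t -> 'I_n | {homo h : i j / (i < j)%N}}.
have pfE (h : I) : exists2 c : k, c != 0 & pfaffian (mxsub (sval h) (sval h) B) = c *: P (sval h).
  by have [c c0 e] := pfaffianE char0 (mxsub (sval h) (sval h) B) t_even; exists c; [exact: c0|rewrite /P pf_form_select; exact: e].
have sortP h : P h = 0 \/ exists (h' : I) c, P h = c * P (sval h').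
  have [h_inj|h_ninj] := pselect (injective h); last first.
    by left; apply: pf_form_select_noninj.
  have [h' [g [h'homo ->]]] := sorted_factor h_inj; right.
  by exists (exist _ h' h'homo), (\det (rowsub g 1%:M : 'M[S]_t)); apply: pf_form_select_comp.
have pI (h : I) : rdvd p (P (sval h)).
  have [c c0 e] := pfE h; have [|a ea] := pP (pfaffian (mxsub (sval h) (sval h) B)).
    by exists (sval h) => //; apply: svalP h.
  exists (c^-1 *: a); rewrite -scalerAl -ea e scalerA mulVf // scale1r //.
have pall h : rdvd p (P h).
  have [->|[h' [c ->]]] := sortP h; first exact: rdvdr0.
  exact: rdvd_mull.
split=> //; have [h0 Ph0] := P_neq0.
have [q qI] : exists q : S, forall h : I, p * Q (sval h) = q * P (sval h).
  apply: gcd_ratio => //.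
  - exact: factorial_mpoly.
  - have [e|[h' [c e]]] := sortP h0; first by rewrite e eqxx in Ph0.
    by exists h'; apply: contraNneq Ph0 => e'; rewrite e e' mulr0.
  - move=> c cP; apply: pmax => _ [h hhomo ->].
    have [a _ ->] := pfE (exist _ h hhomo); rewrite -mul_mpolyC.
    by apply/rdvd_mull/(cP (exist _ h hhomo)).
exists q => h.
have [e|[h1 [c e]]] := sortP h0; first by rewrite e eqxx in Ph0.
have Ph1 : P (sval h1) != 0 by apply: contraNneq Ph0 => e'; rewrite e e' mulr0.
exact: ratio_transfer Ph1 (PQ _ _) (qI _).
Qed.

Lemma sum_degrees :
  (\sum_(i < r) (tdeg (tnth f i)).-1 + tdeg p = t./2)%N.
Proof.
have [pP [q pQ]] := p_gcd; have [s Qs] := Q_neq0; have [h0 Ph0] := P_neq0.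
have p0 : p != 0.
  by apply: contraNneq Ph0 => p0; have [c] := pP h0; rewrite p0 mulr0 => ->.
have q0 : q != 0.
  apply: contraNneq Qs => q0; have := pQ (tnth s); rewrite q0 mul0r => /eqP.
  by rewrite mulf_eq0 (negbTE p0).
have qY : Ysym x q.
  move=> v; apply: (derivation_ratio_eq0 (sym_ad_zmod x v) (sym_adM x v) t_even
    (structure_mx_skew x) (jacobian_mx_structure fY) (map_sym_ad_jacobian v fY)
    (map_sym_ad_structure x_basis v) (map_sym_ad_select x v h0) (mxtrace_ad_mx v x_unimod)
    (pY v) Ph0 (pQ h0)).
(* Since [p] divides every [P h], the relation [p * Q h = q * P h] makes [q] a common divisor of the
   minors [Q h]. *)
have q1 : rdvd q 1.
  apply: (jacobian_free_coprime char0 (erefl (r + t)%N) f_free) => //.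
  - by move=> H; apply: Ysym_comp.
  - by move=> a b; apply: Ysym_div.
  move=> s' s't; have s't' : size s' == t by rewrite s't.
  have := jacobian_select (Tuple s't') => /= ->.
  exact: rdvd_ratio p0 (pQ _) (pP _).
have := pQ (tnth s) => /(congr1 (@tdeg k n)).
have Ps : P (tnth s) != 0.
  by apply: contraNneq (mulf_neq0 p0 Qs) => Ps; rewrite pQ Ps mulr0.
rewrite !tdegM // (tdeg_unit q1) add0n.
have -> : tdeg (P (tnth s)) = t./2.
  apply: tdeg_dhomog => //; rewrite /P pf_form_select; apply: dhomog_pfaffian_sum => i j.
  by rewrite !mxE; apply: dhomog_sym_inj.
suff -> : tdeg (Q (tnth s)) = (\sum_(i < r) (tdeg (tnth f i)).-1)%N by rewrite addnC.
apply: tdeg_dhomog => //.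
(* Degrees by rows: gradients of the generators drop one degree, and the selection rows are
   constant. *)
have -> : (\sum_(i < r) (tdeg (tnth f i)).-1 =
    \sum_(i < r + t) if split i is inl j then (tdeg (tnth f j)).-1 else 0)%N.
  rewrite big_split_ord /= [X in _ = (_ + X)%N]big1 ?addn0 => [|i _].
    by apply: eq_bigr => i _; rewrite -[lshift t i]/(unsplit (inl i)) unsplitK.
  by rewrite -[rshift r i]/(unsplit (inr i)) unsplitK.
apply: dhomog_det => i j; have := splitK i; case: (split i) => i' /= <-.
  by rewrite col_mxEu mxE; apply/dhomog_mderiv/dhomog_generator.
rewrite col_mxEd !mxE; case: eqP => _; first exact: dhomog1.
exact: dhomog0.
Qed.

End SumOfDegrees.

(** A maximal independent family in [Y] is polynomial in [f]; the polynomials expressing it are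
    themselves independent in [r] variables, so [d <= r]. *)
Lemma free_generators_size (k : fieldType) n (Y : {mpoly k[n]} -> Prop) d r
    (f : r.-tuple {mpoly k[n]}) :
  has_trdeg Y d -> freely_generated Y f -> r = d.
Proof.
move=> [[g gY g_ind] max_d] [fY f_ind f_gen]; apply/eqP; rewrite eqn_leq (max_d r f) //=.
have /choice[G eG] i : exists G, tnth g i = G \mPo f by apply: f_gen.
apply: (@alg_independent_size k r d [tuple G i | i < d]) => H HG; apply: g_ind.
have -> : g = [tuple tnth [tuple G i | i < d] i \mPo f | i < d].
  by apply: eq_from_tnth => i; rewrite !tnth_mktuple.
by rewrite -comp_mpolyA HG comp_mpoly0.
Qed.

Theorem corollary19 (k : closedFieldType) (char0 : [pchar k] =i pred0)
  (L : lieAlgType k) (n : nat) (x : n.-tuple L) (x_basis : basis_of {:L} x)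
  (p : {mpoly k[n]}) (p_fund : fundamental_semi_invariant x p)
  (L_JS : JS x p)
  (r : nat) (f : r.-tuple {mpoly k[n]})
  (f_homog : forall i, tnth f i \is homog mdeg)
  (f_free : freely_generated (Ysym x) f) :
  (3 * lie_index L + 2 * tdeg p <= \dim {:L} + 2 * \dim (lie_center L))%N /\
  ((3 * lie_index L + 2 * tdeg p = \dim {:L} + 2 * \dim (lie_center L))%N <->
   (forall i, (tdeg (tnth f i) <= 2)%N)).
Proof.
have [x_unimod pY Y_trdeg] := L_JS.
have r_index := free_generators_size Y_trdeg f_free.
have [t en] : exists t, n = (r + t)%N.
  by exists (n - r)%N; rewrite subnKC // r_index; apply: lie_index_le x_basis.
subst n.
have t_even : ~~ odd t.
  by have [] := exists_principal_pfaffian x_basis char0; rewrite -r_index addKn.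
have sumd := sum_degrees char0 x_basis p_fund x_unimod pY r_index f_homog f_free.
rewrite (dim_lie_center x_basis f_homog f_free) (dimL x_basis) -r_index.
pose d i := tdeg (tnth f i).
have d_gt0 i : (0 < d i)%N := tdeg_generator_gt0 f_free i.
set z := #|_|.
have rz : r = (\sum_(i < r) (d i != 1%N) + z)%N.
  have -> : (\sum_(i < r) (d i != 1%N) = #|[pred i | d i != 1%N]|)%N.
    rewrite -sum1_card [RHS]big_mkcond; apply: eq_bigr => i _.
    by rewrite inE; case: (d i != 1%N).
  by rewrite -[LHS]card_ord -(cardC [pred i | d i == 1%N]) addnC.
(* Termwise, as the degrees are positive. With [A = r - z] and [D + tdeg p = t./2], the right side
   of the claim exceeds the left by [2 * (D - A)]. *)
have [le_sum eq_sum] : (\sum_(i < r) (d i != 1) <= \sum_(i < r) (d i).-1 ?= iff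
    [forall i, (d i <= 2)])%N.
  apply: leqif_sum => i _; split; case: (d i) (d_gt0 i) => [|[|[|e]]] //=.
have et : t = (t./2).*2 by rewrite even_halfK.
rewrite -/d in sumd; set D := (\sum_(i < r) (d i).-1)%N in le_sum eq_sum sumd.
set A := (\sum_(i < r) (d i != 1%N))%N in rz le_sum eq_sum.
split; first by lia.
split=> [e|d2].
  have /forallP d2 : [forall i, (d i <= 2)%N] by rewrite -eq_sum; lia.
  exact: d2.
have /eqP eAD : A == D by rewrite eq_sum; apply/forallP.
lia.
Qed.
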